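(* There exist absolute constants $C, c > 0$ such that the following holds. Let $n \ge 1$ and $1 \le k \le n$ be integers and let $0 < a < 0.03$. Let $K$ and $L$ be symmetric convex bodies in $\mathbb{R}^n$ such that there exist linear subspaces $E, F \subseteq \mathbb{R}^n$ with $\dim E \ge k$, $\dim F \ge n - ak$, $\operatorname{diam}(K \cap E) \le 1$ and $\operatorname{diam}(L \cap F) \le 1$. Then for every $t > C (n/k)^{Ca}$, a random orthogonal operator $U \in \mathcal{O}(n)$ satisfies $$ \mathbb{P}\Big\{ \operatorname{diam}(K \cap UL) > \frac{tn}{k} \Big\} < (ct)^{-k/16}. $$
   Context: A convex body in $\mathbb{R}^n$ is a compact convex set with non-empty interior; it is symmetric if $K = -K$. A section of a body is its intersection with a linear subspace, and the dimension of the section is the dimension of that subspace. Diameters are with respect to the Euclidean norm. $\mathcal{O}(n)$ is the orthogonal group of $\mathbb{R}^n$; the random operator $U$ is distributed according to the normalized Haar (probability) measure on $\mathcal{O}(n)$. ''Absolute constants'' means that $C$ and $c$ do not depend on $n, k, a, K, L, t$. *)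

(* Defs.v *)
From HB Require Import structures.
From mathcomp Require Import all_boot all_order all_algebra.
From mathcomp Require Import all_classical all_reals all_analysis.

Set Implicit Arguments.
Unset Strict Implicit.
Unset Printing Implicit Defensive.

Import Order.TTheory GRing.Theory Num.Theory.
Import numFieldNormedType.Exports.

Local Open Scope classical_set_scope.
Local Open Scope ring_scope.

(* The library's norm `|x| on matrices is the sup norm, hence this definition.
   Both norms induce the library's topology on 'cV[R]_n. *)
Definition enorm (R : realType) (n : nat) (x : 'cV[R]_n) : R :=
  Num.sqrt (\sum_(i < n) x i ord0 ^+ 2).

Definition diam (R : realType) (n : nat) (A : set 'cV[R]_n) : \bar R :=
  ereal_sup [set (enorm (z.1 - z.2))%:E | z in A `*` A].

Definition symmetric_convex_body (R : realType) (n : nat)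
    (K : set 'cV[R]_n) : Prop :=
  [/\ compact K, convex_set K, K^° !=set0 & [set - x | x in K] = K].

(* As a set coerced to a type, [orthogonal_mx R n] carries the subspace topology
   inherited from 'M[R]_n. *)
Definition orthogonal_mx (R : realType) (n : nat) : set 'M[R]_n :=
  [set U | U *m U^T = 1%:M].

Definition orth (R : realType) (n : nat) : Type := set_type (@orthogonal_mx R n).

Lemma orthogonal1 (R : realType) (n : nat) : (1%:M : 'M[R]_n) \in @orthogonal_mx R n.
Proof. by rewrite inE /orthogonal_mx /= trmx1 mulmx1. Qed.

Lemma orthogonalM (R : realType) (n : nat) (U V : orth R n) :
  val U *m val V \in @orthogonal_mx R n.
Proof.
rewrite inE /orthogonal_mx /= trmx_mul mulmxA -(mulmxA (val U)).
have := set_valP V; rewrite /orthogonal_mx /= => ->; rewrite mulmx1.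
by have := set_valP U.
Qed.

HB.instance Definition _ (R : realType) (n : nat) :=
  Topological.on (orth R n).
HB.instance Definition _ (R : realType) (n : nat) :=
  isPointed.Build (orth R n) (exist _ 1%:M (orthogonal1 R n)).

Definition orth_mul (R : realType) (n : nat) (U V : orth R n) : orth R n :=
  exist _ (val U *m val V) (orthogonalM U V).

Definition borel_orth (R : realType) (n : nat) :=
  g_sigma_algebraType (@open (orth R n)).

(* Left invariance characterizes the Haar probability measure of a compact
   group. *)
Definition is_haar (R : realType) (n : nat)
    (P : probability (borel_orth R n) R) : Prop :=
  forall (U : orth R n) (A : set (borel_orth R n)), measurable A ->
    P [set (orth_mul U V : borel_orth R n) | V in A] = P A.

(* Main.v *)
(* Cut the coordinates into about [3n/k] blocks of size [m = k/3].

   Since [K] meets [E] in a small ball, a volume comparison shows that every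
   subspace of codimension [m] contains a unit vector [w] with [|<w, x>| <= 40]
   on [K].  Let [D] be the set of [w] in the unit ball with this bound.  Then for
   every rotation [U] there is a unit [w] in [D] with [U w] zero on the first
   block.  Under Haar measure such a vanishing would be very unlikely if [U D]
   had few separated shadows on the union of the first block with any two others;
   hence for some [U] the set [U D] has many [tau]-separated shadows of length
   [q^(-1/2)], [q] the number of blocks, on such unions.

   Fix such a [U] and a vector [y] with [tau^2 |y|] a large multiple of [q].
   Points of [U K] agreeing off those coordinates have small inner product with
   the differences of the shadows, so sums of shadows and of directions of points
   of [U K] stay separated, and there can only be few such directions.  By
   invariance under rotations of those coordinates, [V y] comes close to [K] with
   probability at most [tau^(m-2)] up to a factor [q^3] and the [m]-th power of
   an absolute constant.

   Finally [L] is bounded on [F], so its points of norm [s = t n / (2k)] have a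
   3-net of size [(5s)^(n - dim F)].  If the diameter of the intersection of [K]
   and [U L] exceeds [2s], star-shapedness gives a point of norm [s] in it, so
   some [y] of the net has [U y] close to [K]; conclude by a union bound with
   [tau] of order [t^(-1/2)]. *)
Require Import Defs.
From HB Require Import structures.
From mathcomp Require Import all_boot all_order all_algebra.
From mathcomp Require Import all_classical all_reals all_analysis.
From mathcomp Require Import measurable_realfun.
From mathcomp Require Import zify ring lra.
Set Implicit Arguments.
Unset Strict Implicit.
Unset Printing Implicit Defensive.
Import Order.TTheory GRing.Theory Num.Theory.
Import numFieldNormedType.Exports.
Local Open Scope classical_set_scope.
Local Open Scope ring_scope.

(** No volume is integrated: sizes are cardinalities of separated families. Grid bounds carry
    constants depending on a basis, and self-similar iteration followed by high roots removes them.

    Comparing numbers of directions under Haar measure costs an absolute constant per coordinate, so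
    it must happen on O(k) coordinates. Three blocks are what it takes: the first supplies the
    vanishing, worth [tau ^ m]; the second carries the large part of [U w]; the third carries the
    large part of [V y]. The third is unknown when [U] is fixed, so the shadows must be spread for
    every choice of it.

    When dim F = n, [L] itself has diameter at most 1 and the event is empty. Otherwise
    [a * k >= 1], which forces [k >= 34] as a < 0.03, and bounds [q ^ 3], up to a constant, by a
    power of [(n / k) ^ (a * k)], which the lower bound on [t] pays for. Then [tau ^ (m - 2)]
    contributes [t ^ (- 13 k / 102)] and the net at most about [t ^ (3 k / 100)]; the difference
    exceeds [k / 16], and the margin pays for the constants. *)

(** * Euclidean inner product and norm *)

Section Euclid.
Variables (R : realType) (n : nat).
Implicit Types (x y z : 'cV[R]_n) (a : R).

Definition dot x y : R := \sum_i x i ord0 * y i ord0.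

Lemma dotC x y : dot x y = dot y x.
Proof. by apply: eq_bigr => i _; rewrite mulrC. Qed.

Lemma dotDl x y z : dot (x + y) z = dot x z + dot y z.
Proof. by rewrite -big_split; apply: eq_bigr => i _; rewrite !mxE mulrDl. Qed.

Lemma dotZl a x z : dot (a *: x) z = a * dot x z.
Proof. by rewrite mulr_sumr; apply: eq_bigr => i _; rewrite !mxE mulrA. Qed.

Lemma dotNl x z : dot (- x) z = - dot x z.
Proof. by rewrite -scaleN1r dotZl mulN1r. Qed.

Lemma dotBl x y z : dot (x - y) z = dot x z - dot y z.
Proof. by rewrite dotDl dotNl. Qed.

Lemma dotDr x y z : dot z (x + y) = dot z x + dot z y.
Proof. by rewrite ![dot z _]dotC dotDl. Qed.

Lemma dotZr a x z : dot z (a *: x) = a * dot z x.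
Proof. by rewrite ![dot z _]dotC dotZl. Qed.

Lemma dotNr x z : dot z (- x) = - dot z x.
Proof. by rewrite ![dot z _]dotC dotNl. Qed.

Lemma dotBr x y z : dot z (x - y) = dot z x - dot z y.
Proof. by rewrite ![dot z _]dotC dotBl. Qed.

Lemma dot0l x : dot 0 x = 0.
Proof. by rewrite -(scale0r 0) dotZl mul0r. Qed.

Lemma dot0r x : dot x 0 = 0.
Proof. by rewrite dotC dot0l. Qed.

Lemma dotxx_ge0 x : 0 <= dot x x.
Proof. by apply: sumr_ge0 => i _; rewrite -expr2 sqr_ge0. Qed.

Lemma enormE x : enorm x = Num.sqrt (dot x x).
Proof. by congr Num.sqrt; apply: eq_bigr => i _; rewrite expr2. Qed.

Lemma enorm_ge0 x : 0 <= enorm x.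
Proof. exact: sqrtr_ge0. Qed.

Lemma sqr_enorm x : enorm x ^+ 2 = dot x x.
Proof. by rewrite enormE sqr_sqrtr// dotxx_ge0. Qed.

Lemma enorm0 : enorm (0 : 'cV[R]_n) = 0.
Proof. by rewrite enormE dot0l sqrtr0. Qed.

Lemma enorm_eq0 x : enorm x = 0 -> x = 0.
Proof.
move=> x0; have := sqr_enorm x; rewrite x0 expr0n/= => /esym/eqP.
rewrite psumr_eq0; last by move=> i _; rewrite -expr2 sqr_ge0.
move=> /allP h; apply/colP => i; have := h i (mem_index_enum _).
by rewrite -expr2 sqrf_eq0 mxE => /eqP.
Qed.

Lemma enorm_gt0 x : x != 0 -> 0 < enorm x.
Proof.
move=> x0; rewrite lt_neqAle enorm_ge0 andbT; apply: contra x0.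
by move=> /eqP/esym/enorm_eq0 ->.
Qed.

Lemma enormZ a x : enorm (a *: x) = `|a| * enorm x.
Proof.
rewrite !enormE dotZl dotZr mulrA -expr2 sqrtrM ?sqr_ge0//.
by rewrite sqrtr_sqr.
Qed.

Lemma enormN x : enorm (- x) = enorm x.
Proof. by rewrite -scaleN1r enormZ normrN1 mul1r. Qed.

Lemma enorm_distC x y : enorm (x - y) = enorm (y - x).
Proof. by rewrite -enormN opprB. Qed.

Lemma cauchy_schwarz x y : dot x y <= enorm x * enorm y.
Proof.
have [->|y0] := eqVneq y 0; first by rewrite dot0r enorm0 mulr0.
have yp := enorm_gt0 y0.
have := dotxx_ge0 ((enorm y ^+ 2) *: x - (dot x y) *: y).
rewrite dotBl !dotBr !dotZl !dotZr (dotC y x) -!sqr_enorm => h.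
have {}h : 0 <= enorm y ^+ 2 * ((enorm x * enorm y) ^+ 2 - dot x y ^+ 2).
  by apply: le_trans h _; rewrite le_eqVlt; apply/orP; left; apply/eqP; ring.
move: h; rewrite pmulr_rge0 ?exprn_gt0// subr_ge0 => h.
apply: le_trans (ler_norm _) _.
rewrite -(ler_pXn2r (n := 2)) ?nnegrE ?mulr_ge0 ?enorm_ge0//.
by rewrite real_normK ?num_real.
Qed.

Lemma ler_enormD x y : enorm (x + y) <= enorm x + enorm y.
Proof.
rewrite -(ler_pXn2r (n := 2)) ?nnegrE ?addr_ge0 ?enorm_ge0// sqr_enorm.
rewrite dotDl !dotDr sqrrD -!sqr_enorm (dotC y x).
by have := cauchy_schwarz x y; lra.
Qed.

Lemma ler_enormB x y : enorm (x - y) <= enorm x + enorm y.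
Proof. by apply: le_trans (ler_enormD _ _) _; rewrite enormN. Qed.

Lemma ler_enorm_dist x y z : enorm (x - z) <= enorm (x - y) + enorm (y - z).
Proof. by have := ler_enormD (x - y) (y - z); rewrite addrA subrK. Qed.

Lemma enorm_sum (I : Type) (s : seq I) (F : I -> 'cV[R]_n) :
  enorm (\sum_(i <- s) F i) <= \sum_(i <- s) enorm (F i).
Proof.
elim: s => [|i s IH]; first by rewrite !big_nil enorm0.
by rewrite !big_cons; apply: le_trans (ler_enormD _ _) _; rewrite lerD2l.
Qed.

Lemma coord_le_enorm x i : `|x i ord0| <= enorm x.
Proof.
rewrite -(ler_pXn2r (n := 2)) ?nnegrE ?enorm_ge0// sqr_enorm real_normK ?num_real//.
rewrite /dot (bigD1 i)//= -expr2 lerDl.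
by apply: sumr_ge0 => j _; rewrite -expr2 sqr_ge0.
Qed.

End Euclid.

Lemma linear_form_bounded (R : realType) n (f : 'cV[R]_n -> R) :
  (forall a u v, f (a *: u + v) = a * f u + f v) ->
  exists2 C, 0 < C & forall v, `|f v| <= C * enorm v.
Proof.
move=> lf.
have f0 : f 0 = 0 by have := lf (-1) 0 0; rewrite scaler0 addr0 mulN1r addNr.
have fE v : f v = \sum_i v i ord0 * f (delta_mx i ord0).
  have fS s : f (\sum_(i <- s) v i ord0 *: delta_mx i ord0) =
              \sum_(i <- s) v i ord0 * f (delta_mx i ord0).
    elim: s => [|i s IH]; first by rewrite !big_nil.
    by rewrite !big_cons lf IH.
  rewrite -fS; congr f; rewrite {1}(matrix_sum_delta v).
  by apply: eq_bigr => i _; rewrite big_ord1.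
exists (1 + \sum_i `|f (delta_mx i ord0)|).
  by rewrite ltr_pwDl// sumr_ge0.
move=> v; rewrite fE; apply: le_trans (ler_norm_sum _ _ _) _.
rewrite mulrDl mul1r mulr_suml -[leLHS]add0r; apply: lerD; first exact: enorm_ge0.
apply: ler_sum => i _; rewrite normrM mulrC ler_wpM2l//.
exact: coord_le_enorm.
Qed.

(** * Separated families in a subspace: grid bounds *)

Section Separated.
Variables (R : realType) (n : nat).
Implicit Types (A : {vspace 'cV[R]_n}) (s : seq 'cV[R]_n) (g : R).

Definition eseparated g s := pairwise (fun x y => g <= enorm (x - y)) s.

Lemma separated_in g s x y :
  eseparated g s -> x \in s -> y \in s -> x != y -> g <= enorm (x - y).
Proof.
elim: s => // z s IH; rewrite /eseparated /= => /andP[/allP zs /IH {}IH].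
rewrite !inE => /predU1P[->|xs] /predU1P[->|ys] //; first by rewrite eqxx.
- by move=> _; exact: zs.
- by move=> _; rewrite enorm_distC; exact: zs.
- exact: IH.
Qed.

Lemma separated_uniq g s : 0 < g -> eseparated g s -> uniq s.
Proof.
move=> g0; elim: s => // z s IH; rewrite /eseparated /= => /andP[/allP zs /IH ->].
rewrite andbT; apply/negP => /zs; rewrite subrr enorm0 leNgt g0//.
Qed.

Lemma pairwise_uniqP (T : eqType) (r : rel T) (s : seq T) :
  uniq s -> (forall x y, x \in s -> y \in s -> x != y -> r x y) -> pairwise r s.
Proof.
elim: s => //= z s IH /andP[zs us] h; apply/andP; split; last first.
  by apply: IH => // x y xs ys; apply: h; rewrite inE ?xs ?ys orbT.
apply/allP => y ys; apply: h; rewrite ?inE ?eqxx ?ys ?orbT//.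
by apply: contraNneq zs => ->.
Qed.

Lemma coord_bounded A : exists2 C, 0 < C &
  forall i v, `|coord (vbasis A) i v| <= C * enorm v.
Proof.
have h i : exists C, 0 < C /\ forall v, `|coord (vbasis A) i v| <= C * enorm v.
  have [|C C0 hC] := @linear_form_bounded R n (coord (vbasis A) i).
    by move=> a u v; rewrite linearP.
  by exists C.
have [C hC] := choice h.
exists (1 + \sum_i C i).
  by rewrite ltr_pwDl// sumr_ge0// => i _; apply/ltW; have [] := hC i.
move=> i v; have [_ /(_ v) h1] := hC i; apply: le_trans h1 _.
rewrite ler_wpM2r ?enorm_ge0// (bigD1 i)//= addrCA lerDl addr_ge0//.
by apply: sumr_ge0 => j _; apply/ltW; have [] := hC j.
Qed.

(** Rounding the coordinates in a basis of [A] to a mesh proportional to [g] is injective on a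
    [g]-separated family. [kappa] depends on the basis and on [R0] but not on [g]; only the exponent
    matters later. *)
Lemma separated_upper A R0 : 0 <= R0 -> exists2 kappa, 0 < kappa &
  forall g s, 0 < g <= 1 -> {in s, forall x, x \in A /\ enorm x <= R0} ->
  eseparated g s -> (size s)%:R <= (kappa / g) ^+ \dim A.
Proof.
move=> R00; have [C C0 hC] := coord_bounded A.
pose B := 1 + \sum_(i < \dim A) enorm (vbasis A)`_i.
have B0 : 0 < B by rewrite ltr_pwDl// sumr_ge0// => i _; exact: enorm_ge0.
have K0 : 0 < 2 * C * R0 * B + 1.
  by rewrite ltr_wpDl// !mulr_ge0// ltW.
exists (2 * C * R0 * B + 1) => // g s /andP[g0 g1] sA gs.
pose h := g / B; have h0 : 0 < h by rewrite divr_gt0.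
pose f i (p : 'cV[R]_n) := (coord (vbasis A) i p + C * R0) / h.
have fge i p : p \in s -> 0 <= f i p.
  move=> /sA[_ pR]; rewrite divr_ge0 ?(ltW h0)// -lerBlDr sub0r.
  have := hC i p; rewrite ler_norml => /andP[+ _]; apply: le_trans.
  by rewrite lerN2 ler_wpM2l// ltW.
have fle i p : p \in s -> f i p <= 2 * C * R0 / h.
  move=> /sA[_ pR]; rewrite ler_wpM2r ?invr_ge0 ?(ltW h0)//.
  have := hC i p; rewrite ler_norml => /andP[_ h1].
  have : C * enorm p <= C * R0 by rewrite ler_wpM2l// ltW.
  by move=> h2; lra.
pose L := Num.trunc (2 * C * R0 / h).
pose phi p := [ffun i : 'I_(\dim A) => inord (Num.trunc (f i p)) : 'I_L.+1].
have phi_inj : {in s &, injective phi}.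
  move=> p p' ps ps' pp'; apply/eqP; apply: contraT => npp.
  suff : enorm (p - p') < g by rewrite ltNge (separated_in gs ps ps' npp).
  have [pA _] := sA _ ps; have [pA' _] := sA _ ps'.
  rewrite (coord_vbasis pA) (coord_vbasis pA') -sumrB.
  apply: le_lt_trans (enorm_sum _ _) _.
  apply: (@le_lt_trans _ _ (\sum_(i < \dim A) h * enorm (vbasis A)`_i)).
    apply: ler_sum => i _; rewrite -scalerBl enormZ ler_wpM2r ?enorm_ge0//.
    have : val (phi p i) = val (phi p' i) by rewrite pp'.
    rewrite !ffunE /= !inordK; last 2 first.
    - by rewrite ltnS; apply: le_truncn; exact: fle.
    - by rewrite ltnS; apply: le_truncn; exact: fle.
    move=> e; have /andP[h1 h2] := truncn_itv (fge i _ ps).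
    have /andP[h3 h4] := truncn_itv (fge i _ ps').
    rewrite e in h1 h2.
    have h5 : `|f i p - f i p'| <= 1.
      rewrite ler_norml; move: h1 h2 h3 h4; rewrite -[X in _ < X]natr1.
      by move=> *; apply/andP; split; lra.
    have -> : coord (vbasis A) i p - coord (vbasis A) i p' = (f i p - f i p') * h.
      by rewrite /f; field; rewrite gt_eqF//=.
    by rewrite normrM (gtr0_norm h0) ler_piMl// ltW.
  rewrite -mulr_sumr /h mulrAC ltr_pdivrMr// ltr_pM2l//.
  by rewrite /B ltrDr.
have h1 : (size s <= L.+1 ^ \dim A)%N.
  have us : uniq [seq phi p | p <- s].
    by rewrite map_inj_in_uniq//; exact: separated_uniq gs.
  have := max_card (mem [seq phi p | p <- s]).
  by rewrite (card_uniqP us) size_map card_ffun !card_ord.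
apply: (@le_trans _ _ ((L.+1 ^ \dim A)%:R)); first by rewrite ler_nat.
rewrite natrX lerXn2r ?nnegrE ?divr_ge0 ?(ltW K0) ?(ltW g0)//.
have : L%:R <= 2 * C * R0 / h.
  by rewrite truncn_le divr_ge0 ?(ltW h0)// !mulr_ge0// ltW.
rewrite /h invf_div mulrA => h2.
by rewrite -(natr1 L) [leRHS]mulrDl mul1r lerD// invf_ge1.
Qed.

(** Grid points of mesh proportional to [g]: two of them differ in some basis coordinate, and a
    coordinate is a bounded functional, so they are [g] apart. *)
Lemma separated_lower A alpha : 0 < alpha -> exists2 kappa, 0 < kappa &
  forall g, 0 < g -> exists s,
  [/\ {in s, forall x, x \in A /\ enorm x <= alpha}, eseparated g s &
    (kappa / g) ^+ \dim A <= (size s)%:R].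
Proof.
move=> a0; have [C C0 hC] := coord_bounded A.
pose B := 1 + \sum_(i < \dim A) enorm (vbasis A)`_i.
have B0 : 0 < B by rewrite ltr_pwDl// sumr_ge0// => i _; exact: enorm_ge0.
exists (alpha / (C * B)) => [|g g0]; first by rewrite divr_gt0 ?mulr_gt0.
pose h := g * C; have h0 : 0 < h by rewrite mulr_gt0.
pose L := Num.trunc (alpha / (h * B)).
have L0 : 0 <= alpha / (h * B) by rewrite divr_ge0 ?mulr_ge0// ltW.
have /andP[L1 L2] := truncn_itv L0.
pose f (j : {ffun 'I_(\dim A) -> 'I_L.+1}) : 'cV[R]_n :=
  \sum_i ((j i)%:R * h) *: (vbasis A)`_i.
have cf j i : coord (vbasis A) i (f j) = (j i)%:R * h.
  by rewrite /f coord_sum_free// (basis_free (vbasisP A)).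
exists [seq f j | j <- enum {ffun 'I_(\dim A) -> 'I_L.+1}]; split.
- move=> _ /mapP[j _ ->]; split.
    apply: memv_suml => i _; apply: memvZ; apply: vbasis_mem.
    by rewrite mem_nth// size_tuple.
  apply: le_trans (enorm_sum _ _) _.
  apply: (@le_trans _ _ (\sum_(i < \dim A) (L%:R * h) * enorm (vbasis A)`_i)).
    apply: ler_sum => i _; rewrite enormZ ler_wpM2r ?enorm_ge0//.
    rewrite ger0_norm; last by rewrite mulr_ge0// ltW.
    by rewrite (ler_wpM2r (ltW h0))// ler_nat -ltnS.
  rewrite -mulr_sumr; apply: (@le_trans _ _ (L%:R * h * B)).
    have Lh : 0 <= L%:R * h by rewrite mulr_ge0// ltW.
    by rewrite (ler_wpM2l Lh)// /B lerDr.
  by rewrite -mulrA -ler_pdivlMr ?mulr_gt0.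
- rewrite /eseparated pairwise_map; apply: pairwise_uniqP; first exact: enum_uniq.
  move=> j j' _ _ /eqP jj' /=.
  have [i ji] : exists i, j i != j' i.
    apply/existsP; apply: contraT; rewrite negb_exists => /forallP h1.
    case: jj'; apply/ffunP => i; apply/eqP; rewrite -[_ == _]negbK; exact: h1.
  have := hC i (f j - f j'); rewrite linearB /= !cf -mulrBl normrM (gtr0_norm h0).
  rewrite -ler_pdivrMl// => h1; apply: le_trans h1.
  rewrite /h [leRHS]mulrC mulrA mulfK ?gt_eqF// ler_peMl ?(ltW g0)//.
  have : (j i : nat) != j' i by [].
  move: (j i : nat) (j' i : nat) => a b.
  by rewrite neq_ltn => /orP[ab|ab]; [rewrite distrC|];
    rewrite -natrB ?(ltnW ab)// normr_nat ler1n subn_gt0.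
- rewrite size_map -cardT card_ffun !card_ord natrX lerXn2r ?nnegrE//.
    by rewrite !divr_ge0 ?mulr_ge0// ltW.
  apply: ltW; apply: le_lt_trans L2; rewrite /h le_eqVlt; apply/orP; left.
  by apply/eqP; field; rewrite !gt_eqF.
Qed.

(** By Bernoulli's inequality. Applied to bounds for [m]-fold iterations, this discards the
    basis-dependent constants of the two grid bounds. *)
Lemma expr_bounded_le1 (x C : R) : (forall m, x ^+ m <= C) -> x <= 1.
Proof.
move=> h; rewrite leNgt; apply/negP => x1.
have x10 : 0 < x - 1 by rewrite subr_gt0.
have b m : m%:R * (x - 1) <= x ^+ m.
  elim: m => [|m IH]; first by rewrite mul0r expr0.
  rewrite exprS -natr1.
  have : 1 <= x ^+ m by rewrite exprn_ege1// ltW.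
  move: IH; move: (x ^+ m) (m%:R : R) => y k h1 h2; nra.
have := b (Num.trunc (C / (x - 1))).+1; have := h (Num.trunc (C / (x - 1))).+1.
have := truncnS_gt (C / (x - 1)); rewrite ltr_pdivrMr//.
by move=> h1 h2 h3; have := lt_le_trans h1 (le_trans h3 h2); rewrite ltxx.
Qed.

End Separated.

(** * Maximal families, packing and covering *)

Lemma exists_maximal_pairwise (T : eqType) (r : rel T) (D : set T) (B : nat) :
  (forall s, {in s, forall x, D x} -> pairwise r s -> (size s <= B)%N) ->
  exists s, [/\ {in s, forall x, D x}, pairwise r s &
    forall x, D x -> exists2 y, y \in s & ~~ r x y].
Proof.
move=> hB.
pose P k := `[< exists s, [/\ {in s, forall x, D x}, pairwise r s & size s = k] >].
have P0 : exists k, P k by exists 0%N; apply/asboolP; exists [::].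
have PB k : P k -> (k <= B)%N by move=> /asboolP[s [s1 s2 <-]]; exact: hB.
case: (ex_maxnP P0 PB) => k /asboolP[s [s1 s2 sk]] kmax.
exists s; split => // x Dx; apply: contrapT => h.
have : P (size s).+1.
  apply/asboolP; exists (x :: s); split => //=.
    by move=> y; rewrite inE => /predU1P[->//|]; exact: s1.
  rewrite s2 andbT; apply/allP => y ys; apply: contrapT => /negP nr.
  by apply: h; exists y.
by move=> /kmax; rewrite sk ltnn.
Qed.

Section Covering.
Variables (R : realType) (n : nat).
Implicit Types (A : {vspace 'cV[R]_n}) (Q T X : set 'cV[R]_n).

Definition convexs Q := forall x y (l : R), 0 <= l <= 1 -> Q x -> Q y ->
  Q (l *: x + (1 - l) *: y).

Definition symmetrics Q := forall x, Q x -> Q (- x).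

Lemma convexs0 Q x : convexs Q -> symmetrics Q -> Q x -> Q 0.
Proof.
move=> cQ sQ Qx; have := cQ x (- x) 2^-1 _ Qx (sQ _ Qx).
have -> : 1 - 2^-1 = 2^-1 :> R by lra.
by rewrite scalerN subrr; apply; lra.
Qed.

Lemma convexsZ Q x (l : R) : convexs Q -> symmetrics Q -> 0 <= l <= 1 -> Q x ->
  Q (l *: x).
Proof.
move=> cQ sQ l01 Qx; have := cQ x 0 l l01 Qx (convexs0 cQ sQ Qx).
by rewrite scaler0 addr0.
Qed.

Lemma convexs_comb Q x y (a b : R) : convexs Q -> 0 <= a -> 0 <= b -> 0 < a + b ->
  Q x -> Q y -> exists2 w, Q w & a *: x + b *: y = (a + b) *: w.
Proof.
move=> cQ a0 b0 ab Qx Qy.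
exists ((a / (a + b)) *: x + (1 - a / (a + b)) *: y).
  apply: cQ => //; rewrite divr_ge0 ?(ltW ab)//= ler_pdivrMr// mul1r lerDl//.
rewrite scalerDr !scalerA; congr (_ *: _ + _ *: _); field; rewrite gt_eqF//.
Qed.

(* The maps [z |-> (x + (eps/4) z) / (1 + eps/4)], [x] in [s], send [Q] into
   itself and have uniformly separated images.  Hence their [m]-fold
   compositions yield [size s ^ m] points of [Q] separated by
   [c (eps/5) ^ m], and the grid bound gives the claim as [m] grows. *)
Lemma packing A Q (r0 R0 eps : R) (s : seq 'cV[R]_n) :
  0 < r0 -> 0 < eps <= 1 -> convexs Q -> symmetrics Q ->
  (forall x, Q x -> x \in A) -> (forall x, x \in A -> enorm x <= r0 -> Q x) ->
  (forall x, Q x -> enorm x <= R0) -> {in s, forall x, Q x} ->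
  pairwise (fun x y => `[< ~ exists2 w, Q w & x - y = eps *: w >]) s ->
  (size s)%:R <= (5 / eps) ^+ \dim A.
Proof.
move=> r00 /andP[e0 e1] cQ sQ QA AQ QR sQs sep.
have e40 : 0 < 1 + eps / 4 by lra.
(* Weights of the contractions; [lam] is eps / (4 + eps), hence at least eps / 5 as eps <= 1, which
   gives the 5 of the bound. *)
pose mu := (1 + eps / 4)^-1; pose lam := eps / 4 * mu.
have mu0 : 0 < mu by rewrite invr_gt0.
have lam0 : 0 < lam by rewrite mulr_gt0// divr_gt0.
have mulam : 1 - mu = lam by rewrite /lam /mu; field; lra.
have lam1 : lam <= 1 by rewrite -mulam lerBlDr lerDl ltW.
have mu1 : mu <= 1 by rewrite -subr_ge0 mulam ltW.
have Q0 : Q 0 by apply: AQ; rewrite ?mem0v// enorm0 ltW.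
have R00 : 0 <= R0 by rewrite -(@enorm0 R n); exact: QR.
pose W := fix W m := if m is m'.+1 then
  [seq mu *: x + lam *: z | x <- s, z <- W m'] else [:: 0 : 'cV[R]_n].
have WQ m : {in W m, forall x, Q x}.
  elim: m => [|m IH] x /=; first by rewrite inE => /eqP ->.
  move=> /allpairsP[[y z] /= [ys zW ->]]; rewrite -mulam.
  by apply: cQ; [rewrite mu1 ltW|exact: sQs|exact: IH].
have Wsize m : size (W m) = (size s ^ m)%N.
  by elim: m => //= m IH; rewrite size_allpairs IH expnS.
pose g0 := Num.min 1 (2 * r0).
have g00 : 0 < g0 by rewrite lt_min ltr01 mulr_gt0.
have g01 : g0 <= 1 by rewrite ge_min lexx.
have lamm m : 0 < lam ^+ m <= 1 by rewrite exprn_gt0//= exprn_ile1// ltW.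
have Wsep m : eseparated (g0 * lam ^+ m) (W m).
  elim: m => // m IH; have WQm := WQ m; rewrite /=.
  move: (W m) IH WQm => V sepV VQ.
  elim: s sQs sep {WQ Wsize W} => // x s IHs sQs; rewrite [pairwise _ _]/=.
  move=> /andP[/allP xs seps].
  rewrite /= /eseparated pairwise_cat; apply/and3P; split; last first.
  - apply: IHs => // y ys; apply: sQs; by rewrite inE ys orbT.
  - rewrite pairwise_map; apply: sub_pairwise sepV => z z' /= h.
    rewrite opprD addrACA subrr add0r -scalerBr enormZ gtr0_norm//.
    by rewrite exprS mulrCA ler_pM2l.
  apply/allrelP => _ p /mapP[z zV ->] /allpairsP[[y z'] /= [ys z'V ->]].
  rewrite leNgt; apply/negP => small.
  have /asboolP := xs _ ys; apply.
  set u := _ - _ in small.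
  have uA : u \in A.
    have sA v : v \in x :: s -> v \in A by move=> /sQs/QA.
    have VA v : v \in V -> v \in A by move=> /VQ/QA.
    have xA := sA x (mem_head _ _); have yA : y \in A by rewrite sA// inE ys orbT.
    by rewrite memvB// memvD// memvZ// VA.
  (* Since lam / mu = eps / 4, the vector [x - y] is eps / 2 times the sum of [u / (2 * lam)] and
     [(z' - z) / 2]. Both lie in [Q], so [x - y] lies in the eps-multiple of [Q], against the
     separation of [x] and [y]. *)
  have Qu : Q ((2 * lam)^-1 *: u).
    apply: AQ; first by rewrite memvZ.
    rewrite enormZ gtr0_norm ?invr_gt0 ?mulr_gt0// ler_pdivrMl ?mulr_gt0//.
    apply: le_trans (ltW small) _; have /andP[l1 l2] := lamm m.
    have g2 : g0 <= 2 * r0 by rewrite ge_min lexx orbT.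
    have -> : 2 * lam * r0 = 2 * r0 * lam by ring.
    apply: ler_pM => //; rewrite ?(ltW g00)// ?exprn_ge0 ?(ltW lam0)//.
    by rewrite exprS ger_pMr.
  have Qz : Q (2^-1 *: z' + (1 - 2^-1) *: (- z)).
    by apply: cQ; [lra|exact: VQ|apply: sQ; exact: VQ].
  exists (2^-1 *: ((2 * lam)^-1 *: u) + (1 - 2^-1) *:
          (2^-1 *: z' + (1 - 2^-1) *: (- z))).
    by apply: cQ => //; lra.
  have -> : 1 - 2^-1 = 2^-1 :> R by lra.
  apply/colP => i; rewrite /u !mxE /lam /mu; field.
  by apply/andP; split; lra.
have [kappa k0 hk] := separated_upper A R00.
have bound m : ((size s)%:R * lam ^+ \dim A) ^+ m <= (kappa / g0) ^+ \dim A.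
  have /andP[lm0 lm1] := lamm m.
  have := hk (g0 * lam ^+ m) (W m).
  rewrite Wsize natrX mulr_gt0//= mulr_ile1 ?(ltW g00) ?(ltW lm0)// => /(_ isT).
  move=> /(_ _ (Wsep m)) h; rewrite exprMn -exprM mulnC exprM.
  rewrite -ler_pdivlMr ?exprn_gt0// -expr_div_n -mulrA -invfM; apply: h.
  by move=> x /WQ Qx; split; [exact: QA|exact: QR].
have := expr_bounded_le1 bound.
rewrite -ler_pdivlMr ?exprn_gt0// mul1r => h; apply: le_trans h _.
rewrite -exprVn lerXn2r ?nnegrE ?invr_ge0 ?(ltW lam0) ?divr_ge0 ?(ltW e0)//.
rewrite -[5 / eps]invf_div lef_pV2 ?posrE ?divr_gt0// /lam /mu.
rewrite -mulrA ler_pM2l// -invfM lef_pV2 ?posrE ?mulr_gt0//; lra.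
Qed.

(** [packing] for the ball of radius [R0] with eps = r / (2 * R0): the points of the eps-multiple of
    this ball have norm at most r / 2, below the separation [r]. *)
Lemma ball_packing A (R0 r : R) (s : seq 'cV[R]_n) : 0 < r -> r <= 2 * R0 ->
  {in s, forall x, x \in A /\ enorm x <= R0} -> eseparated r s ->
  (size s)%:R <= (10 * R0 / r) ^+ \dim A.
Proof.
move=> r0 rR sA sep; have R00 : 0 < R0 by lra.
have -> : 10 * R0 / r = 5 / (r / (2 * R0)) by field; rewrite !gt_eqF.
apply: (@packing A (fun x => x \in A /\ enorm x <= R0) R0 R0) => //.
- by rewrite divr_gt0 ?mulr_gt0//= ler_pdivrMr ?mulr_gt0// mul1r.
- move=> x y l /andP[l0 l1] [xA xR] [yA yR]; split.
    by rewrite memvD ?memvZ.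
  have l10 : 0 <= 1 - l by rewrite subr_ge0.
  apply: le_trans (ler_enormD _ _) _; rewrite !enormZ !ger0_norm//.
  have := ler_wpM2l l0 xR; have := ler_wpM2l l10 yR; lra.
- by move=> x [xA xR]; split; rewrite ?memvN ?enormN.
- by move=> x [].
- by move=> x [].
- apply: sub_pairwise sep => x y h; apply/asboolP => -[w [_ wR] e].
  move: h; rewrite e enormZ gtr0_norm ?divr_gt0 ?mulr_gt0// => h.
  have : r / (2 * R0) * enorm w <= r / (2 * R0) * R0.
    by rewrite ler_pM2l// divr_gt0 ?mulr_gt0.
  have -> : r / (2 * R0) * R0 = r / 2 by field; rewrite gt_eqF.
  lra.
Qed.

(** Iterating the cover [m] times covers [T] by [size ys ^ m] translates of its [q ^ m]-multiple.
    Points of a small ball of [A] separated at a scale proportional to [q ^ m] fall into distinct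
    translates, so the grid bound holds the [m]-th power of the right-hand side above a fixed
    positive constant for all [m]. *)
Lemma cover_card A T (al R0 q : R) (ys : seq 'cV[R]_n) : 0 < al -> 0 < q < 1 ->
  (forall x, T x -> enorm x <= R0) -> (forall x, x \in A -> enorm x <= al -> T x) ->
  (forall x, T x -> exists2 y, y \in ys & exists2 w, T w & x = y + q *: w) ->
  1 <= (size ys)%:R * q ^+ \dim A.
Proof.
move=> al0 /andP[q0 q1] TR AT cov.
have T0 : T 0 by apply: AT; rewrite ?mem0v// enorm0 ltW.
have R00 : 0 <= R0 by rewrite -(@enorm0 R n); exact: TR.
have itr m : exists2 V, size V = (size ys ^ m)%N & forall x, T x ->
    exists2 y, y \in V & exists2 w, T w & x = y + q ^+ m *: w.
  elim: m => [|m [V sV hV]].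
    exists [:: 0] => // x Tx; exists 0; rewrite ?inE//.
    by exists x => //; rewrite scale1r add0r.
  exists [seq v + q ^+ m *: y | v <- V, y <- ys].
    by rewrite size_allpairs sV expnSr.
  move=> x /hV[v vV [w /cov[y yys [w' Tw' ->]] ->]].
  exists (v + q ^+ m *: y); first exact: allpairs_f.
  by exists w' => //; rewrite scalerDr scalerA -exprSr addrA.
have [kappa k0 hk] := separated_lower A al0.
have R1 : 0 < 3 * (R0 + 1) by lra.
have bound m : (kappa / (3 * (R0 + 1))) ^+ \dim A <=
    ((size ys)%:R * q ^+ \dim A) ^+ m.
  have qm : 0 < q ^+ m by rewrite exprn_gt0.
  have g0 : 0 < 3 * (R0 + 1) * q ^+ m by rewrite mulr_gt0.
  have [s [sA sep hs]] := hk _ g0; have [V sV hV] := itr m.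
  have pick x : exists y, x \in s ->
      y \in V /\ exists2 w, T w & x = y + q ^+ m *: w.
    have [xs|_] := boolP (x \in s); last by exists 0.
    have [xA xal] := sA _ xs; have [y yV hy] := hV _ (AT _ xA xal).
    by exists y.
  have [f hf] := choice pick.
  have size_s : (size s <= size ys ^ m)%N.
    rewrite -sV -(size_map f); apply: uniq_leq_size.
      rewrite map_inj_in_uniq; first exact: separated_uniq sep.
      move=> x y xs yss fxy; apply/eqP; apply: contraT => nxy.
      suff : enorm (x - y) < 3 * (R0 + 1) * q ^+ m.
        by rewrite ltNge (separated_in sep xs yss nxy).
      have [_ [w Tw ->]] := hf _ xs; have [_ [w' Tw' ->]] := hf _ yss.
      rewrite fxy opprD addrACA subrr add0r -scalerBr enormZ gtr0_norm//.
      rewrite mulrC ltr_pM2r//; apply: le_lt_trans (ler_enormB _ _) _.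
      have := TR _ Tw; have := TR _ Tw'; lra.
    by move=> _ /mapP[x xs ->]; have [] := hf _ xs.
  have h : (kappa / (3 * (R0 + 1) * q ^+ m)) ^+ \dim A <= (size ys)%:R ^+ m.
    by apply: le_trans hs _; rewrite -natrX ler_nat.
  rewrite [leRHS]exprMn -exprM mulnC exprM -ler_pdivrMr ?exprn_gt0//.
  by rewrite -expr_div_n -mulrA -invfM.
have c0 : 0 < (kappa / (3 * (R0 + 1))) ^+ \dim A by rewrite exprn_gt0// divr_gt0.
move: bound; set x := (size ys)%:R * _ => bound.
have x0 : 0 < x by rewrite -(expr1 x); exact: lt_le_trans c0 (bound 1%N).
rewrite -invf_le1//.
apply: (@expr_bounded_le1 _ _ ((kappa / (3 * (R0 + 1))) ^+ \dim A)^-1) => m.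
by rewrite exprVn lef_pV2 ?posrE// exprn_gt0.
Qed.

Lemma linear_bounded (f : {linear 'cV[R]_n -> 'cV[R]_n}) :
  exists2 C, 0 < C & forall x, enorm (f x) <= C * enorm x.
Proof.
have h i : exists C, 0 < C /\ forall v, `|f v i ord0| <= C * enorm v.
  have [|C C0 hC] := @linear_form_bounded R n (fun v => f v i ord0).
    by move=> a u v; rewrite linearP !mxE.
  by exists C.
have [C hC] := choice h.
exists (1 + \sum_i C i).
  by rewrite ltr_pwDl// sumr_ge0// => i _; apply/ltW; have [] := hC i.
move=> x; rewrite {1}(matrix_sum_delta (f x)).
apply: le_trans (enorm_sum _ _) _; rewrite mulrDl mul1r -[leLHS]add0r.
apply: lerD; first exact: enorm_ge0.
rewrite mulr_suml; apply: ler_sum => i _; rewrite big_ord1 enormZ.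
have -> : enorm (delta_mx i ord0 : 'cV[R]_n) = 1.
  rewrite enormE /dot (bigD1 i)//= big1 ?addr0; first by rewrite mxE !eqxx mul1r sqrtr1.
  by move=> j ji; rewrite mxE (negbTE ji) mul0r.
by rewrite mulr1; have [_] := hC i.
Qed.

(** Take a maximal family in [X] whose images are separated relative to [f X]; [packing] bounds its
    size with the dimension of the target. The error is controlled modulo the kernel of [f] only:
    along the kernel, the applications use a bounded section of the body. *)
Lemma section_cover A X (f : {linear 'cV[R]_n -> 'cV[R]_n}) (r0 R0 eps : R) :
  0 < r0 -> 0 < eps <= 1 -> convexs X -> symmetrics X ->
  (forall x, X x -> f x \in A) -> (forall x, X x -> enorm x <= R0) ->
  (forall v, v \in A -> enorm v <= r0 -> exists2 x, X x & f x = v) ->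
  exists xs : seq 'cV[R]_n, [/\ {in xs, forall x, X x},
    (size xs)%:R <= (5 / eps) ^+ \dim A &
    forall x, X x -> exists2 y, y \in xs &
      exists2 w, X w & f (x - y - eps *: w) = 0].
Proof.
move=> r00 e01 cX sX XA XR AX; have [C C0 hC] := linear_bounded f.
pose Q : set 'cV[R]_n := [set f x | x in X].
pose r x y := `[< ~ exists2 w, Q w & f x - f y = eps *: w >].
have pk s : {in s, forall x, X x} -> pairwise r s ->
    (size s)%:R <= (5 / eps) ^+ \dim A.
  move=> sX' sep; rewrite -(size_map f).
  apply: (@packing A Q r0 (C * R0)) => //.
  - move=> _ _ l l01 [x Xx <-] [y Xy <-].
    exists (l *: x + (1 - l) *: y); first exact: cX.
    by rewrite linearD !linearZ.
  - by move=> _ [x Xx <-]; exists (- x); [exact: sX|rewrite linearN].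
  - by move=> _ [x Xx <-]; exact: XA.
  - move=> _ [x Xx <-]; apply: le_trans (hC x) _.
    by rewrite ler_pM2l//; exact: XR.
  - by move=> _ /mapP[x xs ->]; exists x => //; exact: sX'.
  - by rewrite pairwise_map.
have [|xs [h1 h2 h3]] :=
    @exists_maximal_pairwise _ r X (Num.trunc ((5 / eps) ^+ \dim A)).
  move=> s s1 s2; rewrite truncn_ge_nat; first exact: pk.
  exact: le_trans (pk _ s1 s2).
exists xs; split => //; first exact: pk.
move=> x Xx; have [y yxs] := h3 _ Xx; rewrite /r.
move=> /asboolPn/contrapT[w [v Xv <-] e].
exists y => //; exists v => //.
by rewrite !linearB linearZ /= e subrr.
Qed.

End Covering.

(** * Closed conditions and projections along compact sets *)

Section Continuity.
Variables (R : realType) (T : topologicalType).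

(** Continuity entry by entry reduces closedness claims to real-valued functions. *)
Definition vcont n (f : T -> 'cV[R]_n) := forall i, continuous (fun t => f t i ord0).

Definition mcont n (f : T -> 'M[R]_n) := forall i j, continuous (fun t => f t i j).

Lemma cont_sum (I : Type) (s : seq I) (f : I -> T -> R) :
  (forall i, continuous (f i)) -> continuous (fun t => \sum_(i <- s) f i t).
Proof.
move=> cf; elim: s => [|i s IH].
  rewrite (_ : (fun t => _) = fun=> 0); first by move=> t; exact: cvg_cst.
  by apply/funext => t; rewrite big_nil.
rewrite (_ : (fun t => _) = fun t => f i t + \sum_(j <- s) f j t).
  by move=> t; apply: cvgD; [exact: cf|exact: IH].
by apply/funext => t; rewrite big_cons.
Qed.

Lemma vcont_cst n (v : 'cV[R]_n) : vcont (fun=> v).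
Proof. by move=> i t; exact: cvg_cst. Qed.

Lemma mcont_cst n (v : 'M[R]_n) : mcont (fun=> v).
Proof. by move=> i j t; exact: cvg_cst. Qed.

Lemma vcontZ n (a : T -> R) (f : T -> 'cV[R]_n) :
  continuous a -> vcont f -> vcont (fun t => a t *: f t).
Proof.
move=> ca cf i; rewrite (_ : (fun t => _) = fun t => a t * f t i ord0).
  by move=> t; apply: cvgM; [exact: ca|exact: cf].
by apply/funext => u; rewrite mxE.
Qed.

Lemma vcontB n (f g : T -> 'cV[R]_n) :
  vcont f -> vcont g -> vcont (fun t => f t - g t).
Proof.
move=> cf cg i; rewrite (_ : (fun t => _) = fun t => f t i ord0 - g t i ord0).
  by move=> t; apply: cvgB; [exact: cf|exact: cg].
by apply/funext => u; rewrite !mxE.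
Qed.

Lemma vcontM n (A : T -> 'M[R]_n) (f : T -> 'cV[R]_n) :
  mcont A -> vcont f -> vcont (fun t => A t *m f t).
Proof.
move=> cA cf i; rewrite (_ : (fun t => _) = fun t => \sum_j A t i j * f t j ord0).
  by apply: cont_sum => j t; apply: cvgM; [exact: cA|exact: cf].
by apply/funext => u; rewrite mxE.
Qed.

Lemma cont_dot n (f g : T -> 'cV[R]_n) :
  vcont f -> vcont g -> continuous (fun t => dot (f t) (g t)).
Proof.
by move=> cf cg; apply: cont_sum => i t; apply: cvgM; [exact: cf|exact: cg].
Qed.

Lemma cont_enorm n (f : T -> 'cV[R]_n) : vcont f -> continuous (fun t => enorm (f t)).
Proof.
move=> cf; rewrite (_ : (fun t => _) = fun t => Num.sqrt (dot (f t) (f t))); last first.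
  by apply/funext => u; rewrite enormE.
move=> t; apply: (@continuous_comp _ _ _ (fun t => dot (f t) (f t)) Num.sqrt).
  exact: cont_dot.
exact: sqrt_continuous.
Qed.

Lemma closed_ler (f g : T -> R) :
  continuous f -> continuous g -> closed [set t | f t <= g t].
Proof.
move=> cf cg.
have -> : [set t | f t <= g t] = (fun t => f t - g t) @^-1` [set x | x <= 0].
  by apply/seteqP; split=> t /=; rewrite subr_le0.
apply: preimage_closed; last exact: closed_le.
by move=> t _; apply: cvgB; [exact: cf|exact: cg].
Qed.

Lemma closed_eqr (f g : T -> R) :
  continuous f -> continuous g -> closed [set t | f t = g t].
Proof.
move=> cf cg.
have -> : [set t | f t = g t] = [set t | f t <= g t] `&` [set t | g t <= f t].
  apply/seteqP; split=> t /= => [->//|[h1 h2]]; apply/eqP.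
  by rewrite eq_le h1.
by apply: closedI; exact: closed_ler.
Qed.

Lemma closed_all (I : Type) (P : I -> T -> Prop) :
  (forall i, closed [set t | P i t]) -> closed [set t | forall i, P i t].
Proof.
move=> h; have -> : [set t | forall i, P i t] = \bigcap_(i in setT) [set t | P i t].
  by apply/seteqP; split=> t /= Pt i; [move=> _|]; exact: Pt.
by apply: closed_bigI => i _; exact: h.
Qed.

Lemma closed_imp (Q : Prop) (P : T -> Prop) :
  closed [set t | P t] -> closed [set t | Q -> P t].
Proof.
move=> cP; have [q|nq] := pselect Q.
  rewrite (_ : [set t | Q -> P t] = [set t | P t])//.
  by apply/seteqP; split=> t /= => [/(_ q)|h _].
have -> : [set t | Q -> P t] = setT.
  by apply/seteqP; split=> t //= _ /nq.
exact: closedT.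
Qed.

End Continuity.

(** The tube lemma. It makes the events of the form [some point of a compact set satisfies a closed
    condition] closed, hence Borel. *)
Lemma projection_closed (S T : topologicalType) (C : set T) (D : set (S * T)) :
  compact C -> closed D -> closed [set s | exists2 w, C w & D (s, w)].
Proof.
move=> cC cD; rewrite -openC openE => s /= hs.
have := (compact_near_coveringP C).1 cC S (nbhs s) (fun s' w => ~ D (s', w)).
have hC w : C w -> \near w & s, ~ D (s, w).
  move=> Cw; have : nbhs (s, w) (~` D).
    apply: open_nbhs_nbhs; split; first by rewrite openC.
    by move=> Dsw; apply: hs; exists w.
  move=> [[A B] /= [As Bw] AB]; exists (B, A) => // -[w' s'] /= [Bw' As'].
  exact: AB.
move=> /(_ _ hC); apply: filterS => s' h [w Cw]; exact: h.
Qed.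

Lemma cont_cst (R : realType) (T : topologicalType) (a : R) :
  continuous (fun _ : T => a).
Proof. by move=> t; exact: cvg_cst. Qed.

Lemma vcont_id (R : realType) n : vcont (fun x : 'cV[R]_n => x).
Proof. by move=> i; exact: coord_continuous. Qed.

Lemma vcont_comp (R : realType) (S T : topologicalType) n (f : T -> 'cV[R]_n)
  (g : S -> T) : vcont f -> continuous g -> vcont (fun s => f (g s)).
Proof. by move=> cf cg i s; exact: (continuous_comp (cg s) (cf i (g s))). Qed.

Lemma mcont_comp (R : realType) (S T : topologicalType) n (f : T -> 'M[R]_n)
  (g : S -> T) : mcont f -> continuous g -> mcont (fun s => f (g s)).
Proof. by move=> cf cg i j s; exact: (continuous_comp (cg s) (cf i j (g s))). Qed.

Lemma mcont_val (R : realType) n : mcont (fun U : orth R n => val U).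
Proof.
move=> i j; apply: (@mcont_comp R _ 'M[R]_n n (fun M => M)) => //.
  by move=> i' j'; exact: coord_continuous.
exact: initial_continuous.
Qed.

Section Products.
Variables (R : realType) (S T : topologicalType) (n : nat).

Lemma vcont_fst (f : S -> 'cV[R]_n) : vcont f -> vcont (fun u : S * T => f u.1).
Proof. by move=> cf; apply: (vcont_comp cf) => u; exact: cvg_fst. Qed.

Lemma vcont_snd (f : T -> 'cV[R]_n) : vcont f -> vcont (fun u : S * T => f u.2).
Proof. by move=> cf; apply: (vcont_comp cf) => u; exact: cvg_snd. Qed.

Lemma mcont_fst (f : S -> 'M[R]_n) : mcont f -> mcont (fun u : S * T => f u.1).
Proof. by move=> cf; apply: (mcont_comp cf) => u; exact: cvg_fst. Qed.

End Products.

(** * Convex bodies: compactness, inner ball, nearest points *)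

Section Bodies.
Variables (R : realType) (n : nat).
Implicit Types (K C : set 'cV[R]_n) (x y v : 'cV[R]_n).

Lemma trmx_row_continuous : continuous (trmx : 'rV[R]_n -> 'cV[R]_n).
Proof.
move=> x P [F nF FP].
exists (fun i j => F j i); first by move=> i j; have := nF j i; rewrite mxE.
by move=> y yF; apply: FP => i j /=; rewrite mxE; exact: yF.
Qed.

Lemma ebounded_compact C (M : R) :
  closed C -> (forall x, C x -> enorm x <= M) -> compact C.
Proof.
move=> cC CM; pose B : set 'rV[R]_n := trmx @^-1` C.
have -> : C = [set r^T | r in B].
  apply/seteqP; split => [x Cx|_ [r Br <-]//].
  by exists x^T; rewrite /B/= ?trmxK.
apply: continuous_compact; first exact: (continuous_subspaceT trmx_row_continuous).
apply: bounded_closed_compact; last first.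
  by apply: preimage_closed => // x _; exact: trmx_row_continuous.
exists M; split; first exact: num_real.
move=> y My r Br; apply: le_trans (ltW My).
have M0 : 0 <= M by apply: le_trans (CM _ Br); exact: enorm_ge0.
rewrite -[leLHS]/(mx_norm r) mx_normrE; apply: bigmax_le => // -[i j] _ /=.
apply: le_trans (CM _ Br); rewrite (ord1 i).
by have := coord_le_enorm r^T j; rewrite mxE.
Qed.

Lemma compact_ebounded C : compact C -> exists2 M, 0 < M & forall x, C x -> enorm x <= M.
Proof.
move=> cC; have [[x Cx]|C0] := pselect (C !=set0); last first.
  by exists 1 => // x Cx; case: C0; exists x.
have [|c _ hc] := @compact_EVT_max _ R (@enorm R n) C (ex_intro _ x Cx) cC.
  by apply: continuous_subspaceT; exact: cont_enorm (@vcont_id R n).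
exists (enorm c + 1); first by have := enorm_ge0 c; lra.
by move=> y Cy; have := hc y (mem_set Cy); lra.
Qed.

Lemma body_convexs K : symmetric_convex_body K -> convexs K.
Proof.
move=> [_ cK _ _] x y l /andP[l0 l1] Kx Ky.
have := cK x y (Itv01 l0 l1) (mem_set Kx) (mem_set Ky); rewrite inE.
by rewrite /conv /= .
Qed.

Lemma body_symmetrics K : symmetric_convex_body K -> symmetrics K.
Proof. by move=> [_ _ _ sK] x Kx; rewrite -sK; exists x. Qed.

(** With [x0] interior, [v] is the midpoint of [x0 + v] and [- (x0 - v)]. Coordinates are bounded by
    the Euclidean norm, so small Euclidean balls lie in the sup-norm ball around [x0]. *)
Lemma body_ball K : symmetric_convex_body K ->
  exists2 r0, 0 < r0 & forall v, enorm v <= r0 -> K v.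
Proof.
move=> bK; have cK := body_convexs bK; have sK := body_symmetrics bK.
case: bK => [_ _ [x0 /nbhs_ballP[e /= e0 he]] _].
exists (e / 2) => [|v ve]; first by rewrite divr_gt0.
have hK w : enorm w <= e / 2 -> K (x0 + w).
  move=> we; apply: he; split=> // i j.
  rewrite (ord1 j) /ball/= !mxE opprD addrA subrr sub0r normrN.
  by apply: le_lt_trans (coord_le_enorm w i) _; apply: le_lt_trans we _; lra.
have h1 := hK _ ve; have h2 : K (- (x0 + - v)) by apply: sK; apply: hK; rewrite enormN.
have h3 := cK _ _ 2^-1 _ h1 h2.
have -> : v = 2^-1 *: (x0 + v) + (1 - 2^-1) *: - (x0 - v).
  by apply/colP => i; rewrite !mxE; lra.
by apply: h3; lra.
Qed.

Lemma nearest_point C v : compact C -> C !=set0 -> convexs C ->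
  exists2 p, C p & forall x, C x -> dot (v - p) (x - p) <= 0.
Proof.
move=> cC C0 vC.
have [|p /set_mem Cp hp] := @compact_EVT_min _ R (fun x => enorm (v - x)) C C0 cC.
  apply: continuous_subspaceT; apply: cont_enorm; apply: vcontB.
    exact: vcont_cst.
  exact: vcont_id.
exists p => // x Cx; rewrite leNgt; apply/negP => D0.
set D := dot _ _ in D0; set N := dot (x - p) (x - p).
have N0 : 0 <= N by exact: dotxx_ge0.
have DN : 0 < D + N by lra.
(* This step length is at most 1 and satisfies l * N <= D, so moving from [p] towards [x] by it
   brings the point strictly closer to [v], with no case distinction on [N]. *)
pose l := D / (D + N).
have l0 : 0 < l by rewrite divr_gt0.
have l1 : l <= 1 by rewrite ler_pdivrMr// mul1r lerDl.
have Cy : C (l *: x + (1 - l) *: p) by apply: vC => //; rewrite l1 ltW.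
have := hp _ (mem_set Cy).
rewrite -(ler_pXn2r (n := 2)) ?nnegrE ?enorm_ge0// !sqr_enorm.
have -> : v - (l *: x + (1 - l) *: p) = (v - p) - l *: (x - p).
  by apply/colP => i; rewrite !mxE; ring.
have exp2 (a b : 'cV[R]_n) :
    dot (a - l *: b) (a - l *: b) = dot a a - 2 * l * dot a b + l ^+ 2 * dot b b.
  by rewrite dotBl !dotBr !dotZl !dotZr (dotC b a); ring.
rewrite exp2 -/D -/N => h.
have lN : l * N <= D.
  rewrite /l mulrAC ler_pdivrMr// ; nra.
have : 0 <= l * (l * N - 2 * D) by nra.
rewrite pmulr_rge0//; lra.
Qed.

End Bodies.

(** * Coordinate projections and a functional bounded on a body *)

Section Coordinates.
Variables (R : realType) (n : nat).
Implicit Types (Z W : {set 'I_n}) (x y : 'cV[R]_n) (A : 'M[R]_n).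

Lemma dot_mulmx A x y : dot (A *m x) y = dot x (A^T *m y).
Proof.
rewrite /dot; under eq_bigr do rewrite mxE mulr_suml.
rewrite exchange_big /=; apply: eq_bigr => i _; rewrite mxE mulr_sumr.
by apply: eq_bigr => j _; rewrite mxE; ring.
Qed.

Definition prj Z : 'M[R]_n := diag_mx (\row_i (i \in Z)%:R).

Lemma prjE Z x i : (prj Z *m x) i ord0 = if i \in Z then x i ord0 else 0.
Proof. by rewrite mul_diag_mx !mxE; case: (i \in Z); rewrite ?mul1r ?mul0r. Qed.

Lemma prjT Z : (prj Z)^T = prj Z.
Proof. exact: tr_diag_mx. Qed.

Lemma prjI Z W x : prj Z *m (prj W *m x) = prj (Z :&: W) *m x.
Proof. by apply/colP => i; rewrite !prjE inE; case: (i \in Z). Qed.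

Lemma prjK Z x : prj Z *m (prj Z *m x) = prj Z *m x.
Proof. by rewrite prjI finset.setIid. Qed.

Lemma enorm_prj Z x : enorm (prj Z *m x) <= enorm x.
Proof.
rewrite -(ler_pXn2r (n := 2)) ?nnegrE ?enorm_ge0// !sqr_enorm.
apply: ler_sum => i _; rewrite prjE; case: (i \in Z) => //.
by rewrite mul0r -expr2 sqr_ge0.
Qed.

Lemma enorm_prjS Z W x : Z \subset W -> enorm (prj Z *m x) <= enorm (prj W *m x).
Proof.
move=> ZW; have -> : prj Z *m x = prj Z *m (prj W *m x).
  by rewrite prjI (finset.setIidPl ZW).
exact: enorm_prj.
Qed.

Definition suppv Z : {vspace 'cV[R]_n} :=
  <<[tuple delta_mx (enum_val i) ord0 | i < #|Z|]>>%VS.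

Lemma suppvP Z x : reflect (prj Z *m x = x) (x \in suppv Z).
Proof.
apply: (iffP idP) => [|<-].
  move=> /coord_span ->; rewrite linear_sum; apply: eq_bigr => i _.
  rewrite linearZ; congr (_ *: _); rewrite (nth_map i) ?size_enum_ord//.
  rewrite nth_ord_enum; apply/colP => j; rewrite prjE mxE.
  by case: eqP => [->|_] /=; rewrite ?enum_valP ?if_same.
rewrite (matrix_sum_delta (prj Z *m x)); apply: memv_suml => i _.
rewrite big_ord1 prjE; case: ifPn => iZ; last by rewrite scale0r mem0v.
apply: memvZ; apply: memv_span; apply/mapP.
by exists (enum_rank_in iZ i); rewrite ?mem_enum// enum_rankK_in.
Qed.

Lemma dim_suppv Z : \dim (suppv Z) = #|Z|.
Proof.
rewrite /suppv; set X := [tuple _ | _ < _].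
suff /eqP : free X by rewrite size_tuple.
apply/freeP => k h i.
have := congr1 (fun v : 'cV[R]_n => v (enum_val i) ord0) h.
rewrite mxE summxE (bigD1 i)//= big1 ?addr0.
  by rewrite mxE (nth_map i) ?size_enum_ord// nth_ord_enum mxE !eqxx mulr1.
move=> j ji; rewrite mxE (nth_map i) ?size_enum_ord// nth_ord_enum mxE.
by rewrite (inj_eq enum_val_inj) eq_sym (negbTE ji) mulr0.
Qed.

Definition mxlin A : 'End('cV[R]_n) := linfun (mulmx A : 'cV[R]_n -> 'cV[R]_n).

Lemma mxlinE A x : mxlin A x = A *m x.
Proof. exact: lfunE. Qed.

Lemma dim_limg_conj (A B : 'M[R]_n) Z :
  (\dim (limg (mxlin (A *m prj Z *m B))) <= #|Z|)%N.
Proof.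
have h : (limg (mxlin (A *m prj Z *m B)) <=
          mxlin A @: suppv Z)%VS.
  apply/subvP => _ /memv_imgP[x _ ->]; rewrite mxlinE -!mulmxA -mxlinE.
  apply: memv_img.
  by apply/suppvP; rewrite prjK.
apply: leq_trans (dimvS h) _; rewrite -dim_suppv.
by rewrite -(limg_ker_dim (mxlin A) (suppv Z)) leq_addl.
Qed.

(* If no such [th] existed, separation would make the projection of [K] onto
   [ker Pi] contain the ball of radius 40.  Covering a slice of [K] modulo
   [ker Pi] by [125 ^ m] translates of its [1/25]-multiple, and using that [K]
   meets [E] in a ball of radius [1/2], covers a [2m]-dimensional body by
   [125 ^ m] translates of its [2/25]-multiple: too few by volume. *)
Lemma bounded_functional (K : set 'cV[R]_n) (E : {vspace 'cV[R]_n}) (Pi : 'M[R]_n)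
    (m : nat) :
  symmetric_convex_body K -> (forall x, K x -> x \in E -> enorm x <= 1 / 2) ->
  (0 < m)%N -> (3 * m <= \dim E)%N -> Pi^T = Pi -> Pi *m Pi = Pi ->
  (\dim (limg (mxlin Pi)) <= m)%N ->
  exists th, [/\ enorm th = 1, Pi *m th = 0 & forall x, K x -> dot th x <= 40].
Proof.
move=> bK KE m0 mE PiT PiPi dPi.
have cK := body_convexs bK; have sK := body_symmetrics bK.
have [r0 r00 Kr0] := body_ball bK.
have PiK x : Pi *m (Pi *m x) = Pi *m x by rewrite mulmxA PiPi.
pose C : set 'cV[R]_n := [set x - Pi *m x | x in K].
have vC : convexs C.
  move=> _ _ l l01 [x Kx <-] [y Ky <-]; exists (l *: x + (1 - l) *: y).
    exact: cK.
  by rewrite mulmxDr -!scalemxAr; apply/colP => i; rewrite !mxE; ring.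
have sC : symmetrics C.
  by move=> _ [x Kx <-]; exists (- x); [exact: sK|rewrite mulmxN opprB opprK addrC].
have compK : compact K by case: bK.
have [M M0 KM] := compact_ebounded compK.
have [c c0 hc] := @linear_bounded R n (mulmx Pi : 'cV[R]_n -> 'cV[R]_n).
have CM x : K x -> enorm (x - Pi *m x) <= (1 + c) * M.
  move=> Kx; apply: le_trans (ler_enormB _ _) _.
  by have := hc x; have := KM x Kx; have := enorm_ge0 x; rewrite /=; nra.
have [[v [Piv v40 nCv]]|nex] :=
    pselect (exists v, [/\ Pi *m v = 0, enorm v <= 40 & ~ C v]).
  have compC : compact C.
    apply: (@ebounded_compact R n C ((1 + c) * M)); last first.
      by move=> _ [x Kx <-]; exact: CM.
    pose D : set ('cV[R]_n * 'cV[R]_n) :=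
      [set u : 'cV[R]_n * 'cV[R]_n | forall i, u.1 i ord0 = (u.2 - Pi *m u.2) i ord0].
    have -> : C = [set s | exists2 w, K w & D (s, w)].
      apply/seteqP; split=> s [w Kw h]; exists w => //; first by move=> i /=; rewrite h.
      by apply/colP => i; rewrite -(h i).
    apply: projection_closed => //; apply: closed_all => i; apply: closed_eqr.
      exact: (vcont_fst (@vcont_id R n)).
    have c2 : vcont (fun u : 'cV[R]_n * 'cV[R]_n => u.2).
      exact: (vcont_snd (@vcont_id R n)).
    by apply: vcontB => //; apply: vcontM => //; exact: mcont_cst.
  have C0 : C !=set0 by exists (0 - Pi *m 0); exists 0 => //; apply: Kr0; rewrite enorm0 ltW.
  have [p Cp hp] := nearest_point v compC C0 vC.
  have Pip : Pi *m p = 0 by case: Cp => x _ <-; rewrite mulmxBr PiK subrr.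
  have vp : v - p != 0 by apply: contra_notN nCv => /eqP/subr0_eq ->.
  have vp0 := enorm_gt0 vp.
  exists ((enorm (v - p))^-1 *: (v - p)); split.
  - by rewrite enormZ ger0_norm ?invr_ge0 ?enorm_ge0// mulVf ?gt_eqF.
  - by rewrite -scalemxAr mulmxBr Piv Pip subrr scaler0.
  (* The chain is [dot (v - p) x <= dot (v - p) p <= dot (v - p) v <= 40 * enorm (v - p)], with [x]
     first replaced by [x - Pi *m x], which [v - p] in the kernel of [Pi] does not notice. *)
  move=> x Kx; rewrite dotZl mulrC ler_pdivrMr//.
  have -> : dot (v - p) x = dot (v - p) (x - Pi *m x).
    by rewrite dotBr (dotC _ (Pi *m x)) dot_mulmx PiT mulmxBr Piv Pip subrr dot0r subr0.
  have Cx : C (x - Pi *m x) by exists x.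
  have := hp _ Cx; have := dotxx_ge0 (v - p); rewrite [dot _ (_ - p)]dotBr.
  rewrite [dot _ (_ - Pi *m x - p)]dotBr.
  have := cauchy_schwarz (v - p) v; nra.
have Cker v : Pi *m v = 0 -> enorm v <= 40 -> C v.
  by move=> h1 h2; apply: contrapT => h3; apply: nex; exists v.
exfalso.
pose f := mxlin Pi; pose A := (E :&: lker f)%VS.
have AP x : reflect (x \in E /\ Pi *m x = 0) (x \in A).
  rewrite memv_cap memv_ker mxlinE.
  by apply: (iffP andP) => -[h1 /eqP h2]; split=> //; apply/eqP.
have dimA : (2 * m <= \dim A)%N.
  have h1 : (\dim (f @: E) <= m)%N := leq_trans (dimvS (limgS f (subvf E))) dPi.
  rewrite -(leq_add2r (\dim (f @: E))) limg_ker_dim; apply: leq_trans mE.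
  by rewrite (mulSn 2 m) addnC leq_add2r.
pose X : set 'cV[R]_n := [set x | K x /\ x - Pi *m x \in A].
have vX : convexs X.
  move=> x y l l01 [Kx xA] [Ky yA]; split; first exact: cK.
  have -> : l *: x + (1 - l) *: y - Pi *m (l *: x + (1 - l) *: y) =
      l *: (x - Pi *m x) + (1 - l) *: (y - Pi *m y).
    by rewrite mulmxDr -!scalemxAr; apply/colP => i; rewrite !mxE; ring.
  by rewrite memvD// memvZ.
have sX : symmetrics X.
  move=> x [Kx xA]; split; first exact: sK.
  by rewrite mulmxN -opprD memvN.
have fE x : f x = Pi *m x := mxlinE Pi x.
have fl x : Pi *m x \in limg f by rewrite -fE memv_img ?memvf.
have [|||xs [xsX sxs hxs]] :=
    @section_cover R n (limg f) X (mulmx Pi : 'cV[R]_n -> 'cV[R]_n) r0 M (1 / 25)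
      r00 _ vX sX (fun x _ => fl x).
- lra.
- by move=> x [/KM].
- move=> _ /memv_imgP[x _ ->]; rewrite fE => xr; exists (Pi *m x); last exact: PiK.
  by split; [exact: Kr0|rewrite PiK subrr mem0v].
pose T : set 'cV[R]_n := [set x - Pi *m x | x in X].
have vT : convexs T.
  move=> _ _ l l01 [x Xx <-] [y Xy <-]; exists (l *: x + (1 - l) *: y).
    exact: vX.
  by rewrite mulmxDr -!scalemxAr; apply/colP => i; rewrite !mxE; ring.
have AT v : v \in A -> enorm v <= 40 -> T v.
  move=> vA v40; have /AP[_ Piv] := vA; have [k Kk kv] := Cker _ Piv v40.
  by exists k => //; split => //; rewrite kv.
have h1 : 1 <= (size [seq x - Pi *m x | x <- xs])%:R * (2 / 25) ^+ \dim A :> R.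
  have p1 : 0 < (40 : R) by clear; lra.
  have p2 : 0 < (2 / 25 : R) < 1 by clear; lra.
  have p3 (x : 'cV[R]_n) : T x -> enorm x <= (1 + c) * M by move=> [y [Ky _] <-]; exact: CM.
  refine (cover_card p1 p2 p3 AT _) => _ [x Xx <-]; have [y yxs [w Xw huv]] := hxs _ Xx.
  have Xy := xsX _ yxs.
  exists (y - Pi *m y); first exact: map_f.
  (* This vector is in [A], and it is 2 + 1/25 times a point of [K] in [E], so its norm is at most
     3/2. Hence [25 *: u] has norm at most 75/2, below 40, and lies in [T]: this is where 40 comes
     from. *)
  pose u := x - y - (1 / 25) *: w.
  have Piu : Pi *m u = 0 by [].
  have uA : u \in A.
    have -> : u = (x - Pi *m x) - (y - Pi *m y) - (1 / 25) *: (w - Pi *m w).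
      rewrite -[LHS]subr0 -Piu /u !mulmxBr -scalemxAr.
      by apply/colP => i; rewrite !mxE; ring.
    have [_ xA] := Xx; have [_ yA] := Xy; have [_ wA] := Xw.
    by apply: memvB; [exact: memvB|exact: memvZ].
  have n0 : 0 <= (1 : R) /\ 0 < 1 + 1 :> R /\ 0 <= (2 : R) /\ 0 <= 1 / 25 :> R /\
    0 < 2 + 1 / 25 :> R by clear; lra.
  have [n1 [n2 [n3 [n4 n5]]]] := n0.
  have [z Kz hz] := convexs_comb cK n1 n1 n2 (Xx.1) (sK _ (Xy.1)).
  have [z' Kz' hz'] := convexs_comb cK n3 n4 n5 Kz (sK _ (Xw.1)).
  have uz : u = (2 + 1 / 25) *: z'.
    rewrite -hz' -[2]/(1 + 1) -hz !scale1r /u.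
    by apply/colP => i; rewrite !mxE; ring.
  have u32 : enorm u <= 3 / 2.
    have z'E : z' \in E.
      have -> : z' = (2 + 1 / 25)^-1 *: u.
        by rewrite uz scalerA mulVf ?scale1r//; clear; lra.
      by rewrite memvZ//; have /AP[] := uA.
    have := KE _ Kz' z'E; rewrite uz enormZ ger0_norm; last by clear; lra.
    by clear; move: (enorm z') => e he; lra.
  have Tu : T (25 *: u).
    apply: AT; first by rewrite memvZ.
    rewrite enormZ ger0_norm; last by clear; lra.
    by clear -u32; move: (enorm u) u32 => e he; lra.
  have Tw : T (w - Pi *m w) by exists w.
  exists (2^-1 *: (w - Pi *m w) + (1 - 2^-1) *: (25 *: u)); first by apply: vT => //; clear; lra.
  have -> : x - Pi *m x = u - Pi *m u + (y - Pi *m y) + (1 / 25) *: (w - Pi *m w).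
    rewrite /u !mulmxBr -scalemxAr.
    by apply/colP => i; rewrite !mxE; ring.
  by rewrite Piu; apply/colP => i; rewrite !mxE; clear; lra.
rewrite size_map in h1.
have h2 : (size xs)%:R * (2 / 25) ^+ \dim A <= 125 ^+ m * (2 / 25) ^+ (2 * m) :> R.
  apply: ler_pM => //.
  - apply: le_trans sxs _; have -> : 5 / (1 / 25) = 125 :> R by clear; lra.
    by rewrite ler_weXn2l//; clear; lra.
  - by rewrite ler_wiXn2l//; clear; lra.
have := le_trans h1 h2; rewrite exprM -exprMn.
(* With N in place of 25 the value is 5 * N * (2 / N) ^ 2 = 20 / N, so any N above 20 gives the
   contradiction. *)
have -> : 125 * (2 / 25) ^+ 2 = 4 / 5 :> R by clear; lra.
by rewrite leNgt exprn_ilt1 ?gtn_eqF//; clear; lra.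
Qed.

End Coordinates.

(** * Nets of directions on coordinate spheres *)

Section Caps.
Variables (R : realType) (n : nat).
Implicit Types (Z : {set 'I_n}) (A : {vspace 'cV[R]_n}) (tau : R).

Lemma size_le_sum_count (T : eqType) (r : rel T) (c xs : seq T) :
  {in c, forall y, has (r y) xs} ->
  (size c <= \sum_(z <- xs) count (fun y => r y z) c)%N.
Proof.
elim: xs c => [|z xs IH] c h.
  by rewrite big_nil; case: c h => // y c /(_ y (mem_head _ _)).
rewrite big_cons -(count_predC (fun y => r y z) c) leq_add2l.
rewrite -size_filter; apply: leq_trans (IH _ _) _.
  move=> y; rewrite mem_filter => /andP[/= nyz /h /=].
  by rewrite (negbTE nyz).
by apply: leq_sum => z' _; rewrite count_filter; apply: sub_count => y /andP[].
Qed.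

Lemma ball_packing_at A tau z (c : seq 'cV[R]_n) : 0 < tau -> z \in A ->
  {in c, forall y, y \in A /\ enorm (y - z) <= 2 * tau} -> eseparated tau c ->
  (size c <= 20 ^ \dim A)%N.
Proof.
move=> t0 zA cA sep; rewrite -(ler_nat R) natrX -(size_map (fun y => y - z)).
have -> : 20 = 10 * (2 * tau) / tau :> R by field; rewrite gt_eqF.
apply: ball_packing => //; first lra.
  by move=> _ /mapP[y yc ->]; have [yA yz] := cA _ yc; split => //; exact: memvB.
rewrite /eseparated pairwise_map; apply: sub_pairwise sep => x y /= h.
by rewrite opprB addrA subrK.
Qed.

(** Group the elements [y] of [c] according to a close member of a maximal separated family of the
    images [x y]. Each group lies in a ball of radius 2 * tau, so separation leaves it at most
    [20 ^ \dim A] elements. *)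
Lemma hit_count A tau (c : seq 'cV[R]_n) (x : 'cV[R]_n -> 'cV[R]_n) (M : nat) :
  0 < tau -> {in c, forall y, [/\ y \in A, x y \in A & enorm (x y - y) <= tau]} ->
  eseparated tau c ->
  (forall s, {in s, forall z, exists2 y, y \in c & z = x y} ->
     eseparated tau s -> (size s <= M)%N) ->
  (size c <= M * 20 ^ \dim A)%N.
Proof.
move=> t0 cA sep hM.
have [xs [xs1 xs2 xs3]] := exists_maximal_pairwise hM.
have h : {in c, forall y, has (fun z => enorm (x y - z) < tau) xs}.
  move=> y yc; have [|z zxs] := xs3 (x y); first by exists y.
  by rewrite -ltNge => lt; apply/hasP; exists z.
apply: leq_trans (size_le_sum_count h) _.
apply: (@leq_trans (\sum_(z <- xs) 20 ^ \dim A)%N).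
  rewrite big_seq [leqRHS]big_seq; apply: leq_sum => z /xs1[y0 y0c ->].
  rewrite -size_filter; apply: (@ball_packing_at A tau (x y0)) => //.
  - by have [] := cA _ y0c.
  - move=> y; rewrite mem_filter => /andP[yz /cA[yA _ xy]]; split=> //.
    apply: le_trans (ler_enorm_dist y (x y) (x y0)) _.
    by rewrite (enorm_distC y); lra.
  - by apply: subseq_pairwise sep; exact: filter_subseq.
by rewrite big_const_seq count_predT iter_addn_0 mulnC leq_mul2r hM ?orbT.
Qed.

(** A maximal separated family of unit vectors. Its multiples by [j * tau] with j <= 1 / tau cover
    the unit ball by translates of the 2 * tau-multiple of that ball, so [cover_card] applies; the
    factor tau / 2 is the price of the radii. *)
Lemma caps_exist Z tau : 0 < tau < 1 / 2 -> (0 < #|Z|)%N ->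
  exists c : seq 'cV[R]_n, [/\ {in c, forall y, y \in suppv R Z /\ enorm y = 1},
    eseparated tau c,
    forall u, u \in suppv R Z -> enorm u = 1 ->
      exists2 y, y \in c & enorm (u - y) <= tau &
    (2 * tau)^-1 ^+ #|Z| * (tau / 2) <= (size c)%:R].
Proof.
move=> /andP[t0 t1] Z0; pose D := [set u : 'cV[R]_n | u \in suppv R Z /\ enorm u = 1].
have pk s : {in s, forall x, D x} -> eseparated tau s ->
    (size s)%:R <= (10 * 1 / tau) ^+ \dim (suppv R Z).
  move=> sD; apply: ball_packing => //; first lra.
  by move=> x /sD[h ->].
have [|c [c1 c2 c3]] := @exists_maximal_pairwise _
    (fun x y : 'cV[R]_n => tau <= enorm (x - y)) D
    (Num.trunc ((10 * 1 / tau) ^+ \dim (suppv R Z))).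
  move=> s s1 s2; rewrite truncn_ge_nat; first exact: pk s2.
  exact: le_trans (pk _ s1 s2).
have c4 u : u \in suppv R Z -> enorm u = 1 -> exists2 y, y \in c & enorm (u - y) <= tau.
  move=> uZ u1; have [//|y yc] := c3 u; rewrite -ltNge => lt.
  by exists y => //; exact: ltW.
exists c; split => //.
pose L := Num.trunc tau^-1.
have it0 : 0 <= tau^-1 by rewrite invr_ge0 ltW.
have /andP[L1 L2] := truncn_itv it0.
pose ys := [seq (i%:R * tau) *: y | i <- iota 0 L.+1, y <- c].
have sys : (size ys)%:R <= (size c)%:R * (2 / tau) :> R.
  rewrite size_allpairs size_iota natrM mulrC ler_wpM2l// -natr1.
  have : 1 <= tau^-1 by rewrite invf_ge1//; lra.
  by lra.
pose T := [set v : 'cV[R]_n | v \in suppv R Z /\ enorm v <= 1].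
have [i0 i0Z] : exists i, i \in Z by apply/set0Pn; rewrite -card_gt0.
have [u0 u0Z u01] : exists2 u, u \in suppv R Z & enorm (u : 'cV[R]_n) = 1.
  exists (delta_mx i0 ord0).
    apply/suppvP/colP => j; rewrite prjE !mxE.
    by case: eqP => [->|_]; rewrite ?i0Z ?if_same.
  rewrite enormE /dot (bigD1 i0)//= big1 ?addr0; first by rewrite mxE !eqxx mul1r sqrtr1.
  by move=> j ji; rewrite mxE (negbTE ji) mul0r.
have : 1 <= (size ys)%:R * (2 * tau) ^+ \dim (suppv R Z).
  apply: (@cover_card R n (suppv R Z) T 1 1) => //.
  - by apply/andP; split; lra.
  - by move=> x [].
  move=> v [vZ v1].
  have [u [uZ u1 vu]] : exists u, [/\ u \in suppv R Z, enorm u = 1 & v = enorm v *: u].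
    have [->|v0] := eqVneq v 0; first by exists u0; rewrite enorm0 scale0r.
    have vp := enorm_gt0 v0; exists ((enorm v)^-1 *: v); split.
    - by rewrite memvZ.
    - by rewrite enormZ ger0_norm ?invr_ge0 ?enorm_ge0// mulVf ?gt_eqF.
    - by rewrite scalerA divff ?scale1r ?gt_eqF.
  have [y yc uy] := c4 _ uZ u1; have [yZ y1] := c1 _ yc.
  have vt0 : 0 <= enorm v / tau by rewrite divr_ge0 ?enorm_ge0 ?ltW.
  have /andP[j1 j2] := truncn_itv vt0.
  set j := Num.trunc _ in j1 j2.
  have jL : (j <= L)%N.
    by apply: le_truncn; rewrite -[leRHS]mul1r ler_wpM2r.
  exists ((j%:R * tau) *: y).
    by apply/allpairsP; exists (j, y); split; rewrite ?mem_iota.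
  have jt : j%:R * tau <= enorm v by rewrite -ler_pdivlMr.
  have jt2 : enorm v - j%:R * tau <= tau.
    by move: j2; rewrite ltr_pdivrMr// -natr1 mulrDl mul1r; lra.
  have jt0 : 0 <= j%:R * tau by rewrite mulr_ge0// ltW.
  exists ((2 * tau)^-1 *: (v - (j%:R * tau) *: y)).
    split; first by rewrite memvZ// memvB// memvZ.
    rewrite enormZ ger0_norm ?invr_ge0 ?mulr_ge0 ?(ltW t0)//.
    rewrite ler_pdivrMl ?mulr_gt0// mulr1.
    have -> : v - (j%:R * tau) *: y = (enorm v - j%:R * tau) *: u + (j%:R * tau) *: (u - y).
      by rewrite {1}vu; apply/colP => i; rewrite !mxE; ring.
    apply: le_trans (ler_enormD _ _) _; rewrite !enormZ u1 mulr1 !ger0_norm ?subr_ge0//.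
    have : j%:R * tau * enorm (u - y) <= 1 * tau.
      by apply: ler_pM => //; [exact: enorm_ge0|exact: le_trans jt v1].
    by rewrite mul1r; lra.
  by rewrite scalerA divff ?scale1r ?gt_eqF ?mulr_gt0// addrC subrK.
rewrite dim_suppv => h.
have tt : 0 < (2 * tau) ^+ #|Z| by rewrite exprn_gt0 ?mulr_gt0.
have : 1 <= (size c)%:R * (2 / tau) * (2 * tau) ^+ #|Z|.
  by apply: le_trans h _; rewrite ler_wpM2r// ltW.
move=> {}h.
have -> : (2 * tau)^-1 ^+ #|Z| * (tau / 2) = (2 / tau * (2 * tau) ^+ #|Z|)^-1.
  by rewrite exprVn invfM invf_div mulrC.
have p0 : 0 < 2 / tau * (2 * tau) ^+ #|Z| by rewrite mulr_gt0// divr_gt0.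
by rewrite -[leLHS]mul1r ler_pdivrMr// mulrA.
Qed.

End Caps.

(** * Reflections supported on a set of coordinates *)

Section OrthogonalGroup.
Variables (R : realType) (n : nat).
Implicit Types (Z : {set 'I_n}) (x y u v : 'cV[R]_n) (U V : orth R n).

Lemma orthE U : val U *m (val U)^T = 1%:M.
Proof. exact: (set_valP U). Qed.

Lemma orthET U : (val U)^T *m val U = 1%:M.
Proof. exact: mulmx1C (orthE U). Qed.

Lemma orth_tr_subproof U : (val U)^T \in @orthogonal_mx R n.
Proof. by rewrite inE /orthogonal_mx /= trmxK orthET. Qed.

Definition orth_tr U : orth R n := exist _ (val U)^T (orth_tr_subproof U).

Lemma orth_mulKV U V : orth_mul U (orth_mul (orth_tr U) V) = V.
Proof. by apply: val_inj; rewrite /= mulmxA orthE mul1mx. Qed.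

Lemma dot_orth U x y : dot (val U *m x) (val U *m y) = dot x y.
Proof. by rewrite dot_mulmx mulmxA orthET mul1mx. Qed.

Lemma enorm_orth U x : enorm (val U *m x) = enorm x.
Proof. by rewrite !enormE dot_orth. Qed.

(** The reflection exchanging [u] and [v]. Its normal [u - v] is supported on [Z], so it commutes
    with [prj Z] and leaves the coordinates outside [Z] fixed. *)
Lemma householder Z u v : u \in suppv R Z -> v \in suppv R Z ->
  enorm u = 1 -> enorm v = 1 -> exists H : orth R n, [/\ val H *m u = v,
    forall x, prj R Z *m (val H *m x) = val H *m (prj R Z *m x) &
    forall x, val H *m x - x \in suppv R Z].
Proof.
(* When u = v the convention 2 / 0 = 0 gives c = 0, and [H] is the identity. *)
move=> uZ vZ u1 v1; pose a := u - v; pose c := 2 / dot a a.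
have aZ : a \in suppv R Z by exact: memvB.
pose H : 'M[R]_n := 1%:M - c *: (a *m a^T).
have HE x : H *m x = x - (c * dot a x) *: a.
  rewrite mulmxBl mul1mx -scalemxAl -mulmxA; congr (_ - _).
  have -> : a^T *m x = (dot a x)%:M.
    apply/matrixP => i j; rewrite !ord1 !mxE mulr1n.
    by apply: eq_bigr => k _; rewrite mxE.
  by rewrite mul_mx_scalar scalerA.
have HT : H^T = H.
  by rewrite linearB /= trmx1 linearZ /= trmx_mul trmxK.
have HH x : H *m (H *m x) = x.
  rewrite !HE dotBr dotZr.
  have [a0|a0] := eqVneq (dot a a) 0.
    by rewrite /c a0 invr0 mulr0 !mul0r !scale0r !subr0.
  apply/colP => i; rewrite !mxE /c; field; exact: a0.
have HO : H \in @orthogonal_mx R n.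
  rewrite inE /orthogonal_mx /= HT; apply/matrixP => i j.
  have := congr1 (fun w : 'cV[R]_n => w i ord0) (HH (delta_mx j ord0)).
  by rewrite mulmxA -colE !mxE eqxx andbT.
exists (exist _ H HO); split => /=.
- rewrite HE; have [a0|a0] := eqVneq a 0.
    by rewrite a0 dot0l mulr0 scale0r subr0; apply/eqP; rewrite -subr_eq0 -/a a0.
  have aa : dot a a != 0 by rewrite -sqr_enorm expf_neq0// gt_eqF// enorm_gt0.
  have au : 2 * dot a u = dot a a.
    rewrite /a !dotBl !dotBr (dotC u v) -!sqr_enorm u1 v1; ring.
  have -> : c * dot a u = 1 by rewrite /c mulrAC au divff.
  by rewrite scale1r /a opprB addrC subrK.
- move=> x; rewrite !HE mulmxBr -scalemxAr; have /suppvP -> := aZ.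
  by congr (_ - (_ * _) *: _); rewrite -{1}(suppvP _ _ aZ) dot_mulmx prjT.
- by move=> x; rewrite HE addrAC subrr add0r -scaleNr memvZ.
Qed.

End OrthogonalGroup.

(** * Counting under Haar measure *)

Section Haar.
Variables (R : realType) (n : nat) (P : probability (borel_orth R n) R).
Implicit Types (A B : set (borel_orth R n)).

Lemma orth_closed_measurable A : closed (A : set (orth R n)) -> measurable A.
Proof.
move=> cA; rewrite -[A]setCK; apply: measurableC.
by apply: sub_sigma_algebra; rewrite /= openC.
Qed.

Lemma haar_preimage (U : orth R n) A : is_haar P -> measurable A ->
  P [set V | A (orth_mul U V)] = P A.
Proof.
move=> hP mA; rewrite -(hP (orth_tr U) A mA); congr (P _).
apply/seteqP; split => V /= => [AUV|[W AW <-]].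
  exists (orth_mul U V) => //.
  by apply: val_inj; rewrite /= mulmxA orthET mul1mx.
suff -> : orth_mul U (orth_mul (orth_tr U) W) = W by [].
exact: orth_mulKV.
Qed.

Definition pr A : R := fine (P A).

Lemma prE A : measurable A -> P A = (pr A)%:E.
Proof. by move=> mA; rewrite /pr fineK// fin_num_measure. Qed.

Lemma pr_le A B : measurable A -> measurable B -> A `<=` B -> pr A <= pr B.
Proof.
by move=> mA mB AB; rewrite -lee_fin -!prE// le_measure ?inE.
Qed.

Lemma pr_ge0 A : 0 <= pr A.
Proof. exact: fine_ge0. Qed.

Lemma pr_setT : pr setT = 1.
Proof. by rewrite /pr probability_setT. Qed.

Lemma pr_union (T : Type) (s : seq T) (F : T -> set (borel_orth R n)) A :
  measurable A -> (forall i, measurable (F i)) ->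
  (forall V, A V -> has (fun i => `[< F i V >]) s) ->
  pr A <= \sum_(i <- s) pr (F i).
Proof.
elim: s A => [|i s IH] A mA mF h.
  have -> : A = set0 by apply/seteqP; split => // V /h.
  by rewrite big_nil /pr measure0.
rewrite big_cons; apply: (@le_trans _ _ (pr (F i) + pr (A `\` F i))).
  have mD : measurable (A `\` F i) by exact: measurableD.
  apply: (@le_trans _ _ (pr (F i `|` (A `\` F i)))).
    apply: pr_le => //; first exact: measurableU.
    by move=> V AV; have [|] := pselect (F i V); [left|right].
  by rewrite -lee_fin EFinD -!prE//; [exact: measureU2|exact: measurableU].
rewrite lerD2l; apply: IH => //; first exact: measurableD.
by move=> V [/h /= /orP[/asboolP|]].
Qed.

(** The sum of probabilities is the integral over [A] of the number of events that occur. This turns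
    a pointwise count of caps into a bound on their total probability. *)
Lemma sum_pr_le (T : Type) (s : seq T) (F : T -> set (borel_orth R n)) A (kappa : nat) :
  measurable A -> (forall i, measurable (F i)) -> (forall i, F i `<=` A) ->
  (forall V, A V -> (count (fun i => `[< F i V >]) s <= kappa)%N) ->
  \sum_(i <- s) pr (F i) <= kappa%:R * pr A.
Proof.
move=> mA mF FA hk; rewrite -lee_fin -sumEFin EFinM -prE//.
have -> : (\sum_(i <- s) (pr (F i))%:E =
    \sum_(i <- s) \int[P]_(V in A) (\1_(F i) V)%:E)%E.
  by apply: eq_bigr => i _; rewrite -prE// integral_indic// (setIidl (FA i)).
rewrite -ge0_integral_sum//; last first.
  by move=> i; apply/measurable_EFinP; exact: measurable_indic.
rewrite -integral_cst//; apply: ge0_le_integral => //.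
- by move=> V _; apply: sume_ge0 => i _; rewrite lee_fin.
- by apply: emeasurable_sum => i; apply/measurable_EFinP; exact: measurable_indic.
- move=> V AV; rewrite sumEFin lee_fin; apply: le_trans (_ : (count _ s)%:R <= _); last first.
    by rewrite ler_nat; exact: hk V AV.
  rewrite -sum1_count natr_sum [leRHS]big_mkcond/=; apply: ler_sum => i _.
  rewrite indicE; case: asboolP => h; first by rewrite mem_set.
  by rewrite memNset.
Qed.

End Haar.

(** * Few directions of approach, hence small probability *)

Lemma suppvE (R : realType) n (Z : {set 'I_n}) (x : 'cV[R]_n) :
  (x \in suppv R Z) <-> (forall i, i \notin Z -> x i ord0 = 0).
Proof.
split=> [/suppvP <- i iZ|h]; first by rewrite prjE (negbTE iZ).
by apply/suppvP/colP => i; rewrite prjE; case: ifPn => // /h ->.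
Qed.

(** For distinct [z] and [z'] the squared distance of the sums is at least tau^2 - 2 * (3/8) * tau^2
    = (tau / 2)^2. So the sums [z + v] form a tau / 2-separated family in the ball of radius 2. *)
Lemma sum_packing (R : realType) n (A : {vspace 'cV[R]_n}) (tau : R)
    (zs s : seq 'cV[R]_n) : 0 < tau <= 1 ->
  {in zs, forall z, z \in A /\ enorm z <= 1} -> eseparated tau zs ->
  {in s, forall v, v \in A /\ enorm v <= 1} -> eseparated tau s ->
  (forall z z' v v', z \in zs -> z' \in zs -> v \in s -> v' \in s ->
     - (3 / 8 * tau ^+ 2) <= dot (z - z') (v - v')) ->
  (size zs)%:R * (size s)%:R <= (40 / tau) ^+ \dim A.
Proof.
move=> /andP[t0 t1] zsA sepz sA seps hd.
have -> : 40 / tau = 10 * 2 / (tau / 2) by field; rewrite gt_eqF.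
rewrite -natrM -(size_allpairs (fun z v => z + v) zs s).
apply: ball_packing; [by rewrite divr_gt0|by clear -t1; lra| |].
  move=> _ /allpairsP[[z v] /= [zz vs ->]].
  have [zA z1] := zsA _ zz; have [vA v1] := sA _ vs.
  split; first exact: memvD.
  by apply: le_trans (ler_enormD _ _) _; clear -z1 v1; lra.
elim: zs zsA sepz hd => // z zs IH zsA; rewrite {1}/eseparated /=.
move=> /andP[/allP zzs sepz] hd.
rewrite /eseparated pairwise_cat; apply/and3P; split; last first.
- apply: IH => //; first by move=> x xs; apply: zsA; rewrite inE xs orbT.
  by move=> a b v v' az bz; apply: hd; rewrite inE ?az ?bz orbT.
- rewrite pairwise_map; apply: sub_pairwise seps => x y /= h.
  by rewrite opprD addrACA subrr add0r; apply: le_trans h; clear -t0; lra.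
apply/allrelP => _ _ /mapP[v vs ->] /allpairsP[[z' v'] /= [z'z v's ->]].
have := hd z z' v v'; rewrite !inE eqxx z'z orbT => /(_ isT isT vs v's) hdot.
have := zzs _ z'z => hz.
rewrite -(ler_pXn2r (n := 2)) ?nnegrE ?enorm_ge0 ?divr_ge0 ?(ltW t0)//.
have -> : z + v - (z' + v') = (z - z') + (v - v') by rewrite opprD addrACA.
rewrite sqr_enorm [X in _ <= X]dotDl ![dot _ (_ - _ + _)]dotDr.
rewrite (dotC (v - v') (z - z')) -!(sqr_enorm (_ - _)).
have hz2 : tau ^+ 2 <= enorm (z - z') ^+ 2.
  by rewrite ler_pXn2r ?nnegrE ?enorm_ge0 ?(ltW t0).
have hv2 := sqr_ge0 (enorm (v - v')).
clear -hdot hz2 hv2; rewrite expr_div_n.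
move: (dot _ _) (enorm (z - z') ^+ 2) (enorm (v - v') ^+ 2) (tau ^+ 2) hdot hz2 hv2.
by move=> a b c d h1 h2 h3; lra.
Qed.

Section SmallMeasure.
Variables (R : realType) (n : nat) (P : probability (borel_orth R n) R).
Hypothesis hP : is_haar P.
Variables (W : set 'cV[R]_n) (Z : {set 'I_n}) (y : 'cV[R]_n) (sig tau : R).
Hypotheses (cW : closed W) (Z0 : (0 < #|Z|)%N) (t01 : 0 < tau < 1 / 2).
Hypothesis sig0 : 0 < sig.

Let part (V : orth R n) := prj R Z *m (val V *m y).

Let large := [set V : borel_orth R n | sig <= enorm (part V)].

(** The event speaks of some point of [W] with the direction [l], not of [V y] itself. It depends on
    [V] only through the coordinates outside [Z] and the norm of the part in [Z], which the
    reflections preserve. The ball for [w] supplies compactness. *)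
Let hit (l : 'cV[R]_n) := [set V : borel_orth R n |
  exists2 w : 'cV[R]_n, enorm w <= enorm y &
    [/\ W w, forall i, i \notin Z -> w i ord0 = (val V *m y) i ord0,
      enorm (prj R Z *m w) = enorm (part V) &
      enorm (prj R Z *m w - enorm (part V) *: l) <= tau * enorm (part V)]].

Let near (l : 'cV[R]_n) := [set V : borel_orth R n |
  enorm (part V - enorm (part V) *: l) <= tau * enorm (part V)].

Let vcont_orth : vcont (fun V : orth R n => val V *m y).
Proof. by apply: vcontM; [exact: mcont_val|exact: vcont_cst]. Qed.

Let vcont_part : vcont part.
Proof. by apply: vcontM; [exact: mcont_cst|exact: vcont_orth]. Qed.

Let cont_mul (T : topologicalType) (f g : T -> R) :
  continuous f -> continuous g -> continuous (fun t => f t * g t).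
Proof. by move=> cf cg t; apply: cvgM; [exact: cf|exact: cg]. Qed.

Let measurable_large : measurable large.
Proof.
exact: orth_closed_measurable (closed_ler (@cont_cst _ _ sig) (cont_enorm vcont_part)).
Qed.

Let measurable_near l : measurable (near l).
Proof.
have np := cont_enorm vcont_part.
have nl := cont_enorm (vcontB vcont_part (vcontZ np (@vcont_cst R (orth R n) n l))).
exact: orth_closed_measurable (closed_ler nl (cont_mul (@cont_cst _ _ tau) np)).
Qed.

Let measurable_hit l : measurable (hit l).
Proof.
apply: orth_closed_measurable.
pose D : set (orth R n * 'cV[R]_n) := [set u |
  [/\ W u.2, forall i, i \notin Z -> u.2 i ord0 = (val u.1 *m y) i ord0,
      enorm (prj R Z *m u.2) = enorm (part u.1) &
      enorm (prj R Z *m u.2 - enorm (part u.1) *: l) <= tau * enorm (part u.1)]].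
have -> : hit l = [set s | exists2 w, [set w : 'cV[R]_n | enorm w <= enorm y] w & D (s, w)].
  by [].
have v1 := vcont_fst (T := 'cV[R]_n) vcont_part.
have v2 := vcont_snd (S := orth R n) (@vcont_id R n).
have v3 : vcont (fun u : orth R n * 'cV[R]_n => prj R Z *m u.2).
  by apply: vcontM => //; exact: mcont_cst.
apply: projection_closed.
  apply: (@ebounded_compact R n _ (enorm y)) => //.
  by apply: closed_ler; [exact: cont_enorm (@vcont_id R n)|exact: cont_cst].
have -> : D = [set u : orth R n * 'cV[R]_n | W u.2] `&`
    [set u : orth R n * 'cV[R]_n | forall i, i \notin Z ->
      u.2 i ord0 = (val u.1 *m y) i ord0] `&`
    [set u | enorm (prj R Z *m u.2) = enorm (part u.1)] `&`
    [set u | enorm (prj R Z *m u.2 - enorm (part u.1) *: l) <= tau * enorm (part u.1)].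
  by apply/seteqP; split=> u => [[]|[[[]]]].
apply: closedI; first apply: closedI; first apply: closedI.
- by apply: (@preimage_closed _ _ snd) => // u _; exact: cvg_snd.
- apply: closed_all => i; apply: closed_imp; apply: closed_eqr; first exact: v2.
  exact: (vcont_fst (T := 'cV[R]_n) vcont_orth).
- exact: (closed_eqr (cont_enorm v3) (cont_enorm v1)).
- apply: closed_ler.
    apply: cont_enorm; apply: (vcontB v3).
    by apply: vcontZ; [exact: (cont_enorm v1)|exact: vcont_cst].
  by apply: cont_mul; [exact: cont_cst|exact: (cont_enorm v1)].
Qed.

(* Reflections supported on the coordinates in [Z] preserve [large] and
   [hit l], and permute the events [near l]. *)
Let pr_near_eq l j : l \in suppv R Z -> enorm l = 1 -> j \in suppv R Z -> enorm j = 1 ->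
  pr P (hit l `&` large `&` near j) = pr P (hit l `&` large `&` near l).
Proof.
move=> lZ l1 jZ j1; have [H [Hl Hprj Hoff]] := householder lZ jZ l1 j1.
rewrite /pr -(@haar_preimage _ _ _ H _ hP); last first.
  by apply: measurableI => //; exact: measurableI.
congr (fine (P _)); apply/seteqP.
have partH (V : orth R n) : part (orth_mul H V) = val H *m part V.
  by rewrite /part /= -mulmxA Hprj.
have npart (V : orth R n) : enorm (part (orth_mul H V)) = enorm (part V).
  by rewrite partH enorm_orth.
have offH (V : orth R n) i : i \notin Z ->
    (val (orth_mul H V) *m y) i ord0 = (val V *m y) i ord0.
  move=> iZ; have -> : val (orth_mul H V) *m y = val H *m (val V *m y) by rewrite mulmxA.
  have /suppvE/(_ i iZ)/eqP := Hoff (val V *m y).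
  by rewrite [X in X == _]mxE [X in _ + X]mxE subr_eq0 => /eqP.
have nearH (V : orth R n) : near j (orth_mul H V) <-> near l V.
  rewrite /near /= npart partH -Hl scalemxAr -mulmxBr enorm_orth.
  by [].
have hitH (V : orth R n) : hit l (orth_mul H V) <-> hit l V.
  rewrite /hit /=; split=> -[w wy [h1 h2 h3 h4]]; exists w => //; split => //.
  - by move=> i iZ; rewrite h2// offH.
  - by rewrite h3 npart.
  - by rewrite -(npart V).
  - by move=> i iZ; rewrite h2// offH.
  - by rewrite h3 npart.
  - by rewrite npart.
have largeH (V : orth R n) : large (orth_mul H V) <-> large V.
  by rewrite /large /= npart.
split=> V /= [[h1 h2] h3].
  by split; [split; [exact: (hitH V).1|exact: (largeH V).1]|exact: (nearH V).1].
by split; [split; [exact: (hitH V).2|exact: (largeH V).2]|exact: (nearH V).2].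
Qed.

Let dirE (V : orth R n) : large V ->
  [/\ 0 < enorm (part V), (enorm (part V))^-1 *: part V \in suppv R Z &
  enorm ((enorm (part V))^-1 *: part V) = 1].
Proof.
move=> lV; have p0 : 0 < enorm (part V) by exact: lt_le_trans lV.
split=> //; first by rewrite memvZ//; apply/suppvP; exact: prjK.
by rewrite enormZ ger0_norm ?invr_ge0 ?enorm_ge0// mulVf// gt_eqF.
Qed.

(** Double counting over the caps. By invariance, within [hit l] the vector [V y] itself points to
    [l] with probability at most 20 ^ #|Z| / size c. By [sum_packing], a given [V] hits at most 20 ^
    #|Z| * (40 / tau) ^ #|Z| / size zs caps. The product of the two bounds is compared with the
    lower bound on the size of the net. *)
Lemma small_measure (zs : seq 'cV[R]_n) (del : R) :
  {in zs, forall z, z \in suppv R Z /\ enorm z <= 1} -> eseparated tau zs ->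
  (forall z z' v v', z \in zs -> z' \in zs -> W v -> W v' ->
    v - v' \in suppv R Z -> - del <= dot (z - z') (v - v')) ->
  8 / 3 * del <= tau ^+ 2 * sig ->
  pr P [set V : borel_orth R n | W (val V *m y) /\ sig <= enorm (prj R Z *m (val V *m y))]
    * (size zs)%:R <= (400 * 80) ^+ #|Z| * (2 / tau).
Proof.
move=> zsZ sepz hdel hs; have /andP[t0 t1] := t01.
have tau1 : tau <= 1 by lra.
have [c [cZ sepc covc cN]] := caps_exist t01 Z0.
have [zs0|zs0] := posnP (size zs).
  rewrite zs0 mulr0; apply: mulr_ge0; last by rewrite divr_ge0// ltW.
  by apply: exprn_ge0; rewrite -natrM ler0n.
have rzs0 : 0 < (size zs)%:R :> R by rewrite ltr0n.
pose M := Num.trunc ((40 / tau) ^+ #|Z| / (size zs)%:R).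
have M0 : 0 <= (40 / tau) ^+ #|Z| / (size zs)%:R.
  by rewrite divr_ge0// exprn_ge0// divr_ge0// ltW.
have /andP[M1 _] := truncn_itv M0.
have dimZ := dim_suppv R Z.
have nearc V : large V -> (count (fun l => `[< near l V >]) c <= 20 ^ #|Z|)%N.
  move=> lV; have [p0 uZ u1] := dirE lV; rewrite -size_filter -[leqRHS]mul1n -dimZ.
  (* All images are the direction of [part V], so a separated family of images has at most one
     member. *)
  apply: (@hit_count R n _ tau _ (fun=> (enorm (part V))^-1 *: part V)) => //.
  - move=> l; rewrite mem_filter => /andP[/asboolP nl lc]; split=> //.
      by have [] := cZ _ lc.
    have -> : (enorm (part V))^-1 *: part V - l =
        (enorm (part V))^-1 *: (part V - enorm (part V) *: l).
      by rewrite scalerBr scalerA mulVf ?scale1r// gt_eqF.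
    rewrite enormZ ger0_norm ?invr_ge0 ?enorm_ge0// ler_pdivrMl// mulrC.
    exact: nl.
  - by apply: subseq_pairwise sepc; exact: filter_subseq.
  - move=> [|a [|b s]] //= h; rewrite /eseparated /=.
    have [? _ ->] := h a (mem_head _ _).
    have [|? _ ->] := h b; first by rewrite !inE eqxx orbT.
    by rewrite subrr enorm0 leNgt t0.
have hitc V : large V -> (count (fun l => `[< hit l V >]) c <= M * 20 ^ #|Z|)%N.
  move=> lV; have [p0 uZ u1] := dirE lV; rewrite -size_filter -dimZ.
  have ch l : exists w, hit l V -> [/\ W w,
      forall i, i \notin Z -> w i ord0 = (val V *m y) i ord0,
      enorm (prj R Z *m w) = enorm (part V) &
      enorm (prj R Z *m w - enorm (part V) *: l) <= tau * enorm (part V)].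
    by have [[w _ hw]|nh] := pselect (hit l V); [exists w|exists 0].
  have [f hf] := choice ch.
  pose x l := (enorm (part V))^-1 *: (prj R Z *m f l).
  have xZ l : x l \in suppv R Z by rewrite memvZ//; apply/suppvP; exact: prjK.
  apply: (@hit_count R n _ tau _ x) => //.
  - move=> l; rewrite mem_filter => /andP[/asboolP hl lc]; split=> //.
      by have [] := cZ _ lc.
    have -> : x l - l = (enorm (part V))^-1 *: (prj R Z *m f l - enorm (part V) *: l).
      by rewrite /x scalerBr scalerA mulVf ?scale1r// gt_eqF.
    rewrite enormZ ger0_norm ?invr_ge0 ?enorm_ge0// ler_pdivrMl// mulrC.
    by have [] := hf _ hl.
  - by apply: subseq_pairwise sepc; exact: filter_subseq.
  move=> s hsx seps.
  have sx v : v \in s -> exists l, [/\ W (f l),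
      forall i, i \notin Z -> f l i ord0 = (val V *m y) i ord0,
      enorm (prj R Z *m f l) = enorm (part V) & v = x l].
    move=> /hsx[l]; rewrite mem_filter => /andP[/asboolP hl _] ->.
    by exists l; have [h1 h2 h3 _] := hf _ hl; split.
  have : (size zs)%:R * (size s)%:R <= (40 / tau) ^+ \dim (suppv R Z).
    apply: sum_packing => //; first by rewrite t0 tau1.
      move=> v /sx[l [_ _ h3 ->]]; split=> //.
      by rewrite /x enormZ ger0_norm ?invr_ge0 ?enorm_ge0// h3 mulVf// gt_eqF.
    (* The witnesses agree outside [Z], so their difference is supported on [Z] and [hdel] applies.
       Dividing by [enorm (part V) >= sig] turns [del] into at most 3/8 * tau^2. *)
    move=> z z' v v' zz z'z /sx[l [W1 o1 _ ->]] /sx[l' [W2 o2 _ ->]].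
    have ffZ : f l - f l' \in suppv R Z.
      by apply/suppvE => i iZ; rewrite !mxE o1// o2// subrr.
    rewrite /x -scalerBr -mulmxBr; have /suppvP -> := ffZ.
    rewrite dotZr [leRHS]mulrC.
    have := hdel _ _ _ _ zz z'z W1 W2 ffZ; have : sig <= enorm (part V) by [].
    move: (enorm (part V)) (dot _ _) p0 => e dd e0 he hdd.
    rewrite ler_pdivlMr// mulNr; apply: le_trans hdd; rewrite lerN2.
    have : tau ^+ 2 * sig <= tau ^+ 2 * e by rewrite ler_wpM2l// sqr_ge0.
    by rewrite -mulrA; lra.
  by rewrite dimZ mulrC -ler_pdivlMr// => h; rewrite truncn_ge_nat.
have mH l : measurable (hit l `&` large) by exact: measurableI.
have mHN l j : measurable (hit l `&` large `&` near j) by exact: measurableI.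
set p := pr P _.
have K0 : 0 <= (20 ^ #|Z|)%:R :> R by rewrite ler0n.
have step1 : p <= \sum_(l <- c) pr P (hit l `&` large `&` near l).
  apply: pr_union => //.
    apply: (@measurableI _ _ [set V : borel_orth R n | W (val V *m y)]) => //.
    apply: orth_closed_measurable.
    have -> : [set V : orth R n | W (val V *m y)] = [set V | exists2 w,
        [set w : 'cV[R]_n | enorm w <= enorm y] w &
        ([set u : orth R n * 'cV[R]_n | W u.2] `&`
        [set u : orth R n * 'cV[R]_n | forall i, u.2 i ord0 = (val u.1 *m y) i ord0]) (V, w)].
      apply/seteqP; split=> V /=.
        by move=> WV; exists (val V *m y); rewrite ?enorm_orth//; split.
      by move=> [w _ [Ww /= hw]]; have <- : w = val V *m y by apply/colP.
    apply: projection_closed.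
      apply: (@ebounded_compact R n _ (enorm y)) => //.
      by apply: closed_ler; [exact: cont_enorm (@vcont_id R n)|exact: cont_cst].
    apply: closedI.
      by apply: (@preimage_closed _ _ snd) => // u _; exact: cvg_snd.
    apply: closed_all => i; apply: closed_eqr.
      exact: (vcont_snd (S := orth R n) (@vcont_id R n)).
    exact: (vcont_fst (T := 'cV[R]_n) vcont_orth).
  move=> V /= [WV lV]; have [p0 uZ u1] := dirE lV.
  have [l lc ul] := covc _ uZ u1.
  have nl : near l V.
    rewrite /near /=.
    have -> : part V - enorm (part V) *: l =
        enorm (part V) *: ((enorm (part V))^-1 *: part V - l).
      by rewrite scalerBr scalerA divff ?scale1r// gt_eqF.
    by rewrite enormZ ger0_norm ?enorm_ge0// mulrC ler_wpM2r// enorm_ge0.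
  apply/hasP; exists l => //; apply/asboolP; split=> //; split=> //.
  by exists (val V *m y); rewrite ?enorm_orth//; split.
have step2 l : l \in c -> (size c)%:R * pr P (hit l `&` large `&` near l) <=
    (20 ^ #|Z|)%:R * pr P (hit l `&` large).
  move=> lc; have [lZ l1] := cZ _ lc.
  have -> : (size c)%:R * pr P (hit l `&` large `&` near l) =
      \sum_(j <- c) pr P (hit l `&` large `&` near j).
    rewrite big_seq (eq_bigr (fun=> pr P (hit l `&` large `&` near l))).
      by rewrite -big_seq big_const_seq count_predT iter_addr_0 mulr_natl.
    by move=> j /cZ[jZ j1]; exact: pr_near_eq.
  apply: sum_pr_le => //.
  move=> V [_ lV]; apply: leq_trans (nearc _ lV); apply: sub_count => j /asboolP[_ nj].
  exact/asboolP.
have step3 : \sum_(l <- c) pr P (hit l `&` large) <= (M * 20 ^ #|Z|)%:R.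
  have := @sum_pr_le R n P _ c (fun l => hit l `&` large) setT (M * 20 ^ #|Z|).
  rewrite pr_setT mulr1; apply => // V _.
  have [lV|nl] := pselect (large V).
    apply: leq_trans (hitc _ lV); apply: sub_count => j /asboolP[nj _].
    exact/asboolP.
  rewrite (@eq_count _ _ pred0) ?count_pred0// => j; apply/asboolP.
  by move=> [_].
have step4 : (size c)%:R * p <= (20 ^ #|Z|)%:R * (M * 20 ^ #|Z|)%:R.
  apply: (@le_trans _ _ ((size c)%:R * \sum_(l <- c) pr P (hit l `&` large `&` near l))).
    by rewrite ler_wpM2l.
  rewrite mulr_sumr; apply: (@le_trans _ _ ((20 ^ #|Z|)%:R * \sum_(l <- c) pr P (hit l `&` large))).
    rewrite mulr_sumr big_seq [leRHS]big_seq; apply: ler_sum => l lc; exact: step2.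
  by rewrite ler_wpM2l.
have p0 : 0 <= p by exact: pr_ge0.
have a0 : 0 < (2 * tau)^-1 ^+ #|Z| * (tau / 2).
  by rewrite mulr_gt0 ?divr_gt0// exprn_gt0// invr_gt0 mulr_gt0.
rewrite -(ler_pM2l a0).
(* Here 400 * 80 = 2 * 20 * 20 * 40: the 2 from the size of the net, one 20 from each count of caps,
   the 40 from [sum_packing]. *)
have -> : (2 * tau)^-1 ^+ #|Z| * (tau / 2) * ((400 * 80) ^+ #|Z| * (2 / tau)) =
    20 ^+ #|Z| * 20 ^+ #|Z| * (40 / tau) ^+ #|Z|.
  transitivity ((2 * tau)^-1 ^+ #|Z| * (400 * 80) ^+ #|Z|).
    by rewrite mulrACA [X in _ * X](_ : _ = 1) ?mulr1//; field; rewrite gt_eqF.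
  by rewrite -!exprMn; congr (_ ^+ _); field; rewrite gt_eqF.
apply: (@le_trans _ _ ((size c)%:R * (p * (size zs)%:R))).
  by rewrite ler_wpM2r// mulr_ge0// ltW.
have h1 : M%:R * (size zs)%:R <= (40 / tau) ^+ #|Z| by rewrite -ler_pdivlMr.
rewrite mulrA; apply: (@le_trans _ _ ((20 ^ #|Z|)%:R * (M * 20 ^ #|Z|)%:R * (size zs)%:R)).
  by rewrite ler_wpM2r// ltW.
rewrite natrM natrX (mulrC M%:R) mulrA -mulrA ler_wpM2l// mulr_ge0// exprn_ge0// ler0n.
Qed.

End SmallMeasure.

(** * Shadows that vanish on a block *)

Section BadEvent.
Variables (R : realType) (n : nat) (P : probability (borel_orth R n) R).
Hypothesis hP : is_haar P.
Variables (D : set 'cV[R]_n) (Z Z0 : {set 'I_n}) (beta tau : R) (M : nat).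
Hypotheses (cD : compact D) (ZZ0 : Z0 \subset Z) (Z00 : (0 < #|Z0|)%N).
Hypotheses (b0 : 0 < beta) (t01 : 0 < tau < 1 / 2).

Let shadow (U : orth R n) (w : 'cV[R]_n) := prj R Z *m (val U *m w).

(** The witnesses indexed by 'I_M are a point of a compact product, which makes the event closed.
    Fixing the norm of the shadows at exactly [beta] puts them on one sphere, where directions can
    be counted. *)
Definition spread (U : orth R n) := exists w : 'I_M -> 'cV[R]_n,
  forall i, [/\ D (w i), enorm (shadow U (w i)) = beta &
    forall j, i != j -> tau * beta <= enorm (shadow U (w i) - shadow U (w j))].

Definition bad := [set U : borel_orth R n | ~ spread U /\
  exists2 w, D w & enorm (shadow U w) = beta /\ prj R Z0 *m (val U *m w) = 0].

Let tight := [set U : borel_orth R n | ~ spread U].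

Let touch (l : 'cV[R]_n) := [set U : borel_orth R n | exists2 w, D w &
  enorm (shadow U w) = beta /\ enorm (shadow U w - beta *: l) <= tau * beta].

Let vcont_shadow (T : topologicalType) (f : T -> 'cV[R]_n) : vcont f ->
  vcont (fun u : orth R n * T => shadow u.1 (f u.2)).
Proof.
move=> cf; apply: vcontM; first exact: mcont_cst.
apply: vcontM; last exact: vcont_snd.
exact: (mcont_fst (T := T) (@mcont_val R n)).
Qed.

Let measurable_tight : measurable tight.
Proof.
have -> : tight = ~` [set U | spread U] by [].
apply: measurableC; apply: orth_closed_measurable.
pose T := prod_topology (fun _ : 'I_M => ('cV[R]_n : topologicalType)).
pose C : set T := [set f | forall i, D (f i)].
pose E : set (orth R n * T) := [set u | forall i,
  enorm (shadow u.1 (u.2 i)) = beta /\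
    forall j, i != j -> tau * beta <= enorm (shadow u.1 (u.2 i) - shadow u.1 (u.2 j))].
have -> : [set U | spread U] = [set U | exists2 w, C w & E (U, w)].
  apply/seteqP; split=> U [w].
    by move=> h; exists w => i; [have [] := h i|have [_ h1 h2] := h i; split].
  by move=> Cw Ew; exists w => i; have [h1 h2] := Ew i; split; first exact: Cw.
have vp i : vcont (fun f : T => f i).
  by apply: (vcont_comp (@vcont_id R n)); exact: proj_continuous.
have vs i := vcont_shadow (vp i).
apply: projection_closed; first exact: (tychonoff (fun=> cD)).
apply: closed_all => i; apply: closedI.
  exact: (closed_eqr (cont_enorm (vs i)) (@cont_cst _ _ beta)).
apply: closed_all => j; apply: closed_imp.
exact: (closed_ler (@cont_cst _ _ _) (cont_enorm (vcontB (vs i) (vs j)))).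
Qed.

Let measurable_touch l : measurable (touch l).
Proof.
apply: orth_closed_measurable.
pose E : set (orth R n * 'cV[R]_n) := [set u |
  enorm (shadow u.1 u.2) = beta /\ enorm (shadow u.1 u.2 - beta *: l) <= tau * beta].
have -> : touch l = [set U | exists2 w, D w & E (U, w)] by [].
have vs := vcont_shadow (@vcont_id R n).
apply: projection_closed => //; apply: closedI.
  exact: (closed_eqr (cont_enorm vs) (@cont_cst _ _ beta)).
exact: (closed_ler (cont_enorm (vcontB vs (@vcont_cst _ _ _ _))) (@cont_cst _ _ _)).
Qed.

Let vcont_prj0 : vcont (fun u : orth R n * 'cV[R]_n => prj R Z0 *m (val u.1 *m u.2)).
Proof.
apply: vcontM; first exact: mcont_cst.
apply: vcontM; last exact: (vcont_snd (@vcont_id R n)).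
exact: (mcont_fst (T := 'cV[R]_n) (@mcont_val R n)).
Qed.

Lemma measurable_bad : measurable bad.
Proof.
pose E : set (orth R n * 'cV[R]_n) := [set u | enorm (shadow u.1 u.2) = beta /\
  forall i, (prj R Z0 *m (val u.1 *m u.2)) i ord0 = 0].
have -> : bad = tight `&` [set U | exists2 w, D w & E (U, w)].
  apply/seteqP; split=> U [tU [w Dw [h1 h2]]]; (split; first by []);
    exists w => //; split=> //.
    by move=> i; rewrite /= h2 mxE.
  by apply/colP => i; rewrite [RHS]mxE; exact: h2.
apply: measurableI => //; apply: orth_closed_measurable.
have vs := vcont_shadow (@vcont_id R n).
apply: projection_closed => //; apply: closedI.
  exact: (closed_eqr (cont_enorm vs) (@cont_cst _ _ beta)).
apply: closed_all => i; apply: closed_eqr; [exact: vcont_prj0|exact: cont_cst].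
Qed.

Let pr_touch_eq l j : l \in suppv R Z -> enorm l = 1 -> j \in suppv R Z -> enorm j = 1 ->
  pr P (tight `&` touch j) = pr P (tight `&` touch l).
Proof.
move=> lZ l1 jZ j1; have [H [Hl Hprj Hoff]] := householder lZ jZ l1 j1.
rewrite /pr -(@haar_preimage _ _ _ H _ hP); last by exact: measurableI.
have sH U w : shadow (orth_mul H U) w = val H *m shadow U w.
  by rewrite /shadow /= -mulmxA Hprj.
have spreadH U : spread (orth_mul H U) <-> spread U.
  split=> -[w h]; exists w => i; have [h1 h2 h3] := h i; split=> //.
  - by rewrite -h2 sH enorm_orth.
  - by move=> j' ij; apply: le_trans (h3 _ ij) _; rewrite !sH -mulmxBr enorm_orth.
  - by rewrite sH enorm_orth.
  - by move=> j' ij; rewrite !sH -mulmxBr enorm_orth h3.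
have touchH U : touch j (orth_mul H U) <-> touch l U.
  split=> -[w Dw [h1 h2]]; exists w => //.
    move: h1 h2; rewrite sH enorm_orth => h1 h2; split=> //.
    by move: h2; rewrite -Hl scalemxAr -mulmxBr enorm_orth.
  rewrite sH enorm_orth; split=> //.
  by rewrite -Hl scalemxAr -mulmxBr enorm_orth.
congr (fine (P _)); apply/seteqP; split=> U /= [h1 h2].
  by split; [move=> /(spreadH U).2|exact: (touchH U).1].
by split; [move=> /(spreadH U).1|exact: (touchH U).2].
Qed.

(* Any [tau]-separated family of directions in [shadow U D] of length above [M]
   would witness [spread U]. *)
Let tight_size U (s : seq 'cV[R]_n) : tight U ->
  {in s, forall v, exists2 w, D w & enorm (shadow U w) = beta /\
     v = beta^-1 *: shadow U w} ->
  eseparated tau s -> (size s <= M)%N.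
Proof.
move=> tU hs sep; rewrite leqNgt; apply/negP => Ms; apply: tU.
have ch (i : 'I_M) : exists w, D w /\ enorm (shadow U w) = beta /\
     nth 0 s i = beta^-1 *: shadow U w.
  have [|w Dw h] := hs (nth 0 s i); first by rewrite mem_nth// (ltn_trans (ltn_ord i)).
  by exists w.
have [w hw] := choice ch; exists w => i; have [h1 [h2 h3]] := hw i; split=> // j ij.
have /(pairwiseP 0) h := sep.
have bE : shadow U (w i) - shadow U (w j) = beta *: (nth 0 s i - nth 0 s j).
  have [_ [_ ->]] := hw j.
  by rewrite h3 -scalerBr scalerA divff ?scale1r// gt_eqF.
rewrite bE enormZ gtr0_norm// mulrC ler_pM2l//.
have ltM (k : 'I_M) : (k < size s)%N by exact: ltn_trans (ltn_ord k) Ms.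
have : (i : nat) != j by [].
rewrite neq_ltn => /orP[lt|lt]; last rewrite enorm_distC.
  by apply: h => //; rewrite inE ltM.
by apply: h => //; rewrite inE ltM.
Qed.

(** Without spread, [U] touches at most M * 20 ^ #|Z| caps, and by invariance all caps are touched
    equally often. A shadow vanishing on [Z0] touches one of the caps in [L], so the probability is
    at most the proportion of these caps in the net times M * 20 ^ #|Z|. *)
Lemma bad_le : pr P bad * tau <= (400 * 20) ^+ #|Z| * (2 * M%:R * tau ^+ #|Z0|).
Proof.
have /andP[t0 t1] := t01.
have Z1 : (0 < #|Z|)%N by exact: leq_trans (subset_leq_card ZZ0).
have [c [cZ sepc covc cN]] := caps_exist t01 Z1.
have dimZ := dim_suppv R Z.
pose Y := Z :\: Z0.
pose inL l := `[< exists z, [/\ z \in suppv R Y, enorm z = 1 & enorm (z - l) <= tau] >].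
pose L := [seq l <- c | inL l].
have YZ v : v \in suppv R Y -> v \in suppv R Z.
  move=> /suppvE h; apply/suppvE => i iZ; apply: h.
  by rewrite inE (negbTE iZ) andbF.
(* The caps near the sphere of the coordinates in [Y] are counted with exponent #|Y| in place of
   #|Z|. The difference #|Z0| of the exponents becomes the factor tau ^ #|Z0|. *)
have cL : (size L)%:R <= (10 / tau) ^+ #|Y| * 20 ^+ #|Z| :> R.
  have ch l : exists z, inL l -> [/\ z \in suppv R Y, enorm z = 1 & enorm (z - l) <= tau].
    by have [/asboolP[z hz]|_] := boolP (inL l); [exists z|exists 0].
  have [x hx] := choice ch.
  pose M' := Num.trunc ((10 / tau) ^+ #|Y| : R).
  have m0 : 0 <= (10 / tau) ^+ #|Y| :> R by rewrite exprn_ge0// divr_ge0// ltW.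
  have /andP[M1 _] := truncn_itv m0.
  have : (size L <= M' * 20 ^ \dim (suppv R Z))%N.
    apply: (@hit_count R n _ tau _ x) => //.
    - move=> l; rewrite mem_filter => /andP[/hx[h1 h2 h3] lc]; split=> //.
        by have [] := cZ _ lc.
      exact: YZ.
    - by apply: subseq_pairwise sepc; exact: filter_subseq.
    - move=> s hs seps; rewrite truncn_ge_nat// -(dim_suppv R Y).
      have -> : 10 / tau = 10 * 1 / tau by rewrite mulr1.
      apply: ball_packing => //; first by lra.
      move=> v /hs[l]; rewrite mem_filter => /andP[/hx[h1 h2 h3] _] ->.
      by rewrite h1 h2.
  rewrite dimZ -(ler_nat R) natrM natrX => h; apply: le_trans h _.
  by rewrite ler_wpM2r// exprn_ge0.
have mT l : measurable (tight `&` touch l) by exact: measurableI.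
have step1 : pr P bad <= \sum_(l <- L) pr P (tight `&` touch l).
  apply: pr_union => //; first exact: measurable_bad.
  move=> U [tU [w Dw [wb w0]]].
  pose z := beta^-1 *: shadow U w.
  have zZ : z \in suppv R Z by rewrite memvZ//; apply/suppvP; exact: prjK.
  have z1 : enorm z = 1.
    by rewrite /z enormZ gtr0_norm ?invr_gt0// wb mulVf// gt_eqF.
  have [l lc zl] := covc _ zZ z1.
  have zY : z \in suppv R Y.
    apply/suppvE => i; rewrite inE negb_and negbK => /orP[iZ0|iZ]; last first.
      by have /suppvE/(_ i iZ) := zZ.
    rewrite /z mxE /shadow prjE (fintype.subsetP ZZ0 _ iZ0).
    have := congr1 (fun v : 'cV[R]_n => v i ord0) w0.
    by rewrite prjE iZ0 [X in _ = X]mxE => ->; rewrite mulr0.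
  apply/hasP; exists l.
    by rewrite mem_filter lc andbT; apply/asboolP; exists z.
  apply/asboolP; split=> //; exists w => //; split=> //.
  have -> : shadow U w - beta *: l = beta *: (z - l).
    by rewrite /z scalerBr scalerA divff ?scale1r// gt_eqF.
  by rewrite enormZ gtr0_norm// mulrC ler_wpM2r// ltW.
have step2 l : l \in c -> (size c)%:R * pr P (tight `&` touch l) <= (M * 20 ^ #|Z|)%:R.
  move=> lc; have [lZ l1] := cZ _ lc.
  have -> : (size c)%:R * pr P (tight `&` touch l) =
      \sum_(j <- c) pr P (tight `&` touch j).
    rewrite big_seq (eq_bigr (fun=> pr P (tight `&` touch l))).
      by rewrite -big_seq big_const_seq count_predT iter_addr_0 mulr_natl.
    by move=> j /cZ[jZ j1]; exact: pr_touch_eq.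
  have := @sum_pr_le R n P _ c (fun j => tight `&` touch j) setT (M * 20 ^ #|Z|).
  rewrite pr_setT mulr1; apply => // U _.
  have [tU|nt] := pselect (tight U); last first.
    rewrite (@eq_count _ _ pred0) ?count_pred0// => j; apply/asboolP.
    by move=> [].
  rewrite -size_filter -dimZ.
  have ch j : exists w, touch j U -> [/\ D w, enorm (shadow U w) = beta &
      enorm (shadow U w - beta *: j) <= tau * beta].
    by have [[w Dw [h1 h2]]|nh] := pselect (touch j U); [exists w|exists 0].
  have [f hf] := choice ch.
  apply: (@hit_count R n _ tau _ (fun j => beta^-1 *: shadow U (f j))) => //.
  - move=> j; rewrite mem_filter => /andP[/asboolP[_ tj] jc].
    have [h1 h2 h3] := hf _ tj; split.
    + by have [] := cZ _ jc.
    + by rewrite memvZ//; apply/suppvP; exact: prjK.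
    + have -> : beta^-1 *: shadow U (f j) - j = beta^-1 *: (shadow U (f j) - beta *: j).
        by rewrite scalerBr scalerA mulVf ?scale1r// gt_eqF.
      by rewrite enormZ gtr0_norm ?invr_gt0// ler_pdivrMl// mulrC.
  - by apply: subseq_pairwise sepc; exact: filter_subseq.
  - move=> s hs seps; apply: (tight_size tU _ seps) => v /hs[j].
    rewrite mem_filter => /andP[/asboolP[_ tj] _] ->.
    by have [h1 h2 h3] := hf _ tj; exists (f j).
have step3 : (size c)%:R * pr P bad <= (size L)%:R * (M * 20 ^ #|Z|)%:R.
  apply: (@le_trans _ _ ((size c)%:R * \sum_(l <- L) pr P (tight `&` touch l))).
    by rewrite ler_wpM2l.
  rewrite mulr_sumr big_seq.
  apply: (@le_trans _ _ (\sum_(l <- L | l \in L) (M * 20 ^ #|Z|)%:R)).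
    by apply: ler_sum => l; rewrite mem_filter => /andP[_]; exact: step2.
  by rewrite -big_seq big_const_seq count_predT iter_addr_0 mulr_natl.
set p := pr P bad in step3 *; have p0 : 0 <= p by exact: pr_ge0.
have cardZ : #|Z| = (#|Z0| + #|Y|)%N.
  by rewrite /Y cardsD (finset.setIidPr ZZ0) subnKC// subset_leq_card.
have a0 : 0 < (2 * tau)^-1 ^+ #|Z| * (tau / 2).
  by rewrite mulr_gt0 ?divr_gt0// exprn_gt0// invr_gt0 mulr_gt0.
have tY : 0 < tau ^+ #|Y| by rewrite exprn_gt0.
have h1 : (2 * tau)^-1 ^+ #|Z| * (tau / 2) * p <=
    (10 / tau) ^+ #|Y| * 20 ^+ #|Z| * (M%:R * 20 ^+ #|Z|).
  apply: (@le_trans _ _ ((size c)%:R * p)); first by rewrite ler_wpM2r.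
  apply: le_trans step3 _; rewrite natrM natrX ler_wpM2r// mulr_ge0// exprn_ge0//.
have h2 : 10 ^+ #|Y| <= 10 ^+ #|Z| :> R.
  by rewrite ler_eXn2l ?subset_leq_card ?subsetDl//; lra.
have t0Z : 0 < tau ^+ #|Z| by rewrite exprn_gt0.
have -> : p * tau = (2 * tau) ^+ #|Z| * 2 * ((2 * tau)^-1 ^+ #|Z| * (tau / 2) * p).
  rewrite exprVn; set E := (2 * tau) ^+ #|Z|.
  have E0 : 0 < E by rewrite exprn_gt0// mulr_gt0.
  by field; rewrite gt_eqF.
have E0 : 0 <= (2 * tau) ^+ #|Z| * 2 by rewrite mulr_ge0// exprn_ge0// mulr_ge0// ltW.
apply: le_trans (ler_wpM2l E0 h1) _.
have -> : (2 * tau) ^+ #|Z| * 2 * ((10 / tau) ^+ #|Y| * 20 ^+ #|Z| * (M%:R * 20 ^+ #|Z|)) =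
    (20 * 20 * 2) ^+ #|Z| * 10 ^+ #|Y| * (2 * M%:R * (tau ^+ #|Z| / tau ^+ #|Y|)).
  by rewrite expr_div_n !exprMn; ring.
have -> : tau ^+ #|Z| / tau ^+ #|Y| = tau ^+ #|Z0|.
  by rewrite cardZ exprD mulfK// gt_eqF.
(* The factor 2 comes from the size of the net, each 20 from a use of [hit_count], and 10 from the
   packing bound on [Y]. *)
have -> : (400 * 20 : R) = (20 * 20 * 2) * 10 by ring.
rewrite [(_ * 10) ^+ _]exprMn ler_wpM2r//.
  by rewrite !mulr_ge0// exprn_ge0// ltW.
by rewrite ler_wpM2l// exprn_ge0// !mulr_ge0.
Qed.

End BadEvent.

(** * Blocks of coordinates *)

Section Blocks.
Variables (R : realType) (n m : nat).
Hypotheses (m0 : (0 < m)%N) (mn : (m <= n)%N).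

Definition blk (b : nat) : {set 'I_n} := [set i : 'I_n | (i %/ m)%N == b].

(** The additional block collects the remainder of the division; it is empty when [m] divides
    [n]. *)
Definition nblk := (n %/ m)%N.+1.

Lemma card_blk b : (#|blk b| <= m)%N.
Proof.
have := @leq_card_in _ _ (fun i : 'I_n => Ordinal (ltn_pmod i m0)) (mem (blk b)).
rewrite card_ord; apply=> i j; rewrite !inE => /eqP ib /eqP jb [] ij.
by apply/val_inj; rewrite /= (divn_eq i m) (divn_eq j m) ib jb ij.
Qed.

Lemma card_blk0 : #|blk 0| = m.
Proof.
apply/eqP; rewrite eqn_leq card_blk /=.
have <- : #|widen_ord mn @: 'I_m| = m.
  rewrite card_imset ?card_ord// => i j /(congr1 val) /= ij; exact: val_inj.
apply: subset_leq_card; apply/fintype.subsetP => _ /imsetP[i _ ->].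
by rewrite inE /= divn_small.
Qed.

Definition blk3 b b' := blk 0 :|: blk b :|: blk b'.

Lemma card_blk3 b b' : (#|blk3 b b'| <= 3 * m)%N.
Proof.
apply: leq_trans (leq_of_leqif (leq_card_setU _ _)) _.
rewrite (mulSn 2) (mulSn 1) mul1n addnA; apply: leq_add (card_blk b').
apply: leq_trans (leq_of_leqif (leq_card_setU _ _)) _.
exact: leq_add (card_blk 0) (card_blk b).
Qed.

(** Pigeonhole on the squared norms of the blocks. It serves both for [U w], before the spread is
    known, and for [V y], afterwards. *)
Lemma large_block (x : 'cV[R]_n) :
  exists b : 'I_nblk, (Num.sqrt nblk%:R)^-1 * enorm x <= enorm (prj R (blk b) *m x).
Proof.
have q0 : 0 < nblk%:R :> R by rewrite ltr0n.
have s0 : 0 < Num.sqrt nblk%:R :> R by rewrite sqrtr_gt0.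
have sumb : \sum_(b < nblk) enorm (prj R (blk b) *m x) ^+ 2 = enorm x ^+ 2.
  rewrite sqr_enorm /dot; under eq_bigr do rewrite sqr_enorm /dot.
  rewrite exchange_big /=; apply: eq_bigr => i _.
  have ib : (i %/ m < nblk)%N by rewrite ltnS leq_div2r// ltnW.
  rewrite (bigD1 (Ordinal ib))//= big1 ?addr0 ?prjE ?inE ?eqxx// => b bi.
  rewrite prjE inE ifN ?mul0r//; apply: contra bi => /eqP e.
  by apply/eqP/val_inj; rewrite /= e.
apply: contrapT => nex.
pose c := (Num.sqrt nblk%:R)^-1 * enorm x.
have c0 : 0 <= c by rewrite mulr_ge0 ?enorm_ge0// invr_ge0 ltW.
have lt (b : 'I_nblk) : enorm (prj R (blk b) *m x) ^+ 2 < c ^+ 2.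
  rewrite ltr_pXn2r ?nnegrE ?enorm_ge0//.
  by rewrite ltNge; apply/negP => h; apply: nex; exists b.
have : \sum_(b < nblk) enorm (prj R (blk b) *m x) ^+ 2 < \sum_(b < nblk) c ^+ 2.
  by apply: ltr_sum; first by apply/hasP; exists ord0; rewrite ?mem_index_enum.
rewrite sumb sumr_const card_ord -mulr_natl exprMn exprVn (sqr_sqrtr (ltW q0)).
by rewrite mulVKf ?gt_eqF// ltxx.
Qed.

Variable P : probability (borel_orth R n) R.
Hypothesis hP : is_haar P.

(* For every rotation some element of [D] vanishes on block 0 and has a large
   component in some block [b].  If for every [U] and [b] some [b'] failed, the
   events [bad] would cover the orthogonal group, against [bad_le]. *)
Lemma exists_spread (D : set 'cV[R]_n) (tau : R) (M : nat) :
  compact D -> (forall w (l : R), 0 <= l <= 1 -> D w -> D (l *: w)) ->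
  (forall U : orth R n, exists w, [/\ D w, enorm w = 1 &
     prj R (blk 0) *m (val U *m w) = 0]) -> 0 < tau < 1 / 2 ->
  nblk%:R ^+ 2 * ((400 * 20) ^+ (3 * m) * (2 * M%:R * tau ^+ m)) < tau ->
  exists U : orth R n, exists b, forall b' : 'I_nblk,
    spread D (blk3 b b') (Num.sqrt nblk%:R)^-1 tau M U.
Proof.
move=> cD sD hD t01 hM; have /andP[t0 t1] := t01; apply: contrapT => nex.
pose beta : R := (Num.sqrt nblk%:R)^-1.
have be0 : 0 < beta by rewrite invr_gt0 sqrtr_gt0 ltr0n.
pose F (bb : 'I_nblk * 'I_nblk) := bad D (blk3 bb.1 bb.2) (blk 0) beta tau M.
have mF bb : measurable (F bb) by exact: measurable_bad.
have cov (U : borel_orth R n) : setT U ->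
    has (fun bb => `[< F bb U >]) (index_enum _).
  move=> _; have [w [Dw w1 w0]] := hD U; have [b hb] := large_block (val U *m w).
  have [b' nb'] : exists b' : 'I_nblk, ~ spread D (blk3 b b') beta tau M U.
    apply: contrapT => h; apply: nex; exists U, b => b'; apply: contrapT => h'.
    by apply: h; exists b'.
  apply/hasP; exists (b, b'); first exact: mem_index_enum.
  apply/asboolP; split=> //=.
  set s := enorm (prj R (blk3 b b') *m (val U *m w)).
  have bs : beta <= s.
    rewrite enorm_orth w1 mulr1 in hb; apply: le_trans hb _; apply: enorm_prjS.
    by apply/fintype.subsetP => i ib; rewrite /blk3 !finset.in_setU ib orbT.
  have s0 : 0 < s by exact: lt_le_trans bs.
  (* Star-shapedness of [D] allows shrinking the shadow to norm exactly [beta], as [bad] demands. *)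
  exists ((beta / s) *: w).
    by apply: sD => //; rewrite divr_ge0 ?(ltW be0) ?(ltW s0)//= ler_pdivrMr// mul1r.
  split; last by rewrite -!scalemxAr w0 scaler0.
  rewrite -!scalemxAr enormZ -/s gtr0_norm ?divr_gt0//.
  by rewrite divfK// gt_eqF.
have := pr_union P measurableT mF cov.
rewrite pr_setT; apply/negP; rewrite -ltNge.
apply: (@le_lt_trans _ _ (\sum_(bb : 'I_nblk * 'I_nblk)
    (400 * 20) ^+ (3 * m) * (2 * M%:R * tau ^+ m) / tau)).
  apply: ler_sum => bb _; rewrite ler_pdivlMr//.
  apply: (@le_trans _ _ ((400 * 20) ^+ #|blk3 bb.1 bb.2| * (2 * M%:R * tau ^+ #|blk 0|))).
    apply: bad_le => //; last by rewrite card_blk0.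
    by apply/fintype.subsetP => i i0; rewrite /blk3 !finset.in_setU i0.
  rewrite card_blk0 ler_wpM2r//.
    by rewrite !mulr_ge0// exprn_ge0// ltW.
  have p1 : 1 <= 400 * 20 :> R by rewrite -natrM ler1n.
  exact: (ler_weXn2l p1 (card_blk3 _ _)).
have cardq : #|{: 'I_nblk * 'I_nblk}| = (nblk * nblk)%N by rewrite card_prod !card_ord.
rewrite sumr_const cardq -[X in X < _]mulr_natl natrM -expr2 mulrA.
by rewrite ltr_pdivrMr// mul1r.
Qed.

End Blocks.

(** * Probability that a rotated vector comes close to the body *)

Section OrbitProbability.
Variables (R : realType) (n : nat) (P : probability (borel_orth R n) R).
Hypothesis hP : is_haar P.
Variables (K : set 'cV[R]_n) (E : {vspace 'cV[R]_n}) (m : nat).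
Hypotheses (bK : symmetric_convex_body K) (m0 : (0 < m)%N).
Hypothesis KE : forall x, K x -> x \in E -> enorm x <= 1 / 2.
Hypothesis mE : (3 * m <= \dim E)%N.

Let D := [set w : 'cV[R]_n | enorm w <= 1 /\ forall x, K x -> dot w x <= 40].

Let compact_D : compact D.
Proof.
apply: (@ebounded_compact R n _ 1); last by move=> x [].
apply: closedI; first exact: (closed_ler (cont_enorm (@vcont_id R n)) (@cont_cst _ _ 1)).
apply: closed_all => x; apply: closed_imp.
exact: (closed_ler (cont_dot (@vcont_id R n) (@vcont_cst R _ n x)) (@cont_cst _ _ 40)).
Qed.

Let star_D w (l : R) : 0 <= l <= 1 -> D w -> D (l *: w).
Proof.
move=> /andP[l0 l1] [w1 hw]; split.
  by rewrite enormZ ger0_norm// mulr_ile1// enorm_ge0.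
move=> x Kx; rewrite dotZl.
apply: (@le_trans _ _ (l * 40)); first by rewrite ler_wpM2l// hw.
by rewrite ler_piMl.
Qed.

Lemma mulmx_prj (Z : {set 'I_n}) : prj R Z *m prj R Z = prj R Z.
Proof.
apply/matrixP => i j; rewrite mul_diag_mx !mxE.
by case: (i \in Z); rewrite ?mul1r// !mul0r mul0rn.
Qed.

Let dimn : (\dim E <= n)%N.
Proof. by apply: leq_trans (dimvS (subvf E)) _; rewrite dimvf /dim /= muln1. Qed.

Let mn : (m <= n)%N. Proof. by have := dimn; lia. Qed.

Let vanishing (U : orth R n) : exists w, [/\ D w, enorm w = 1 &
  prj R (blk n m 0) *m (val U *m w) = 0].
Proof.
(* The kernel of this conjugate consists of the [w] for which [U w] vanishes on block 0. *)
pose Pi := (val U)^T *m prj R (blk n m 0) *m val U.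
have UU := orthE U.
have [|||th [th1 Pth hth]] := @bounded_functional R n K E Pi m bK KE m0 mE.
- by rewrite /Pi !trmx_mul trmxK prjT mulmxA.
- rewrite /Pi -!mulmxA (mulmxA (val U) _) UU mul1mx (mulmxA (prj _ _)).
  by rewrite mulmx_prj.
- apply: leq_trans (dim_limg_conj _ _ _) _; exact: card_blk.
exists th; split=> //; first by split; rewrite ?th1.
have := congr1 (mulmx (val U)) Pth.
by rewrite /Pi -!mulmxA mulmxA UU mul1mx mulmx0.
Qed.

Let near_K := [set v : 'cV[R]_n | exists2 x, K x & enorm (v - x) <= 3].

Definition visit (y : 'cV[R]_n) := [set V : borel_orth R n | near_K (val V *m y)].

Let q : R := (nblk n m)%:R.

Let closed_near (A : 'M[R]_n) : closed [set v : 'cV[R]_n | near_K (A *m v)].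
Proof.
pose F : set ('cV[R]_n * 'cV[R]_n) := [set u | enorm (A *m u.1 - u.2) <= 3].
have -> : [set v | near_K (A *m v)] = [set v | exists2 x, K x & F (v, x)] by [].
apply: projection_closed; first by case: bK.
apply: closed_ler; last exact: cont_cst.
apply: cont_enorm; apply: vcontB; last exact: vcont_snd (@vcont_id R n).
by apply: vcontM; [exact: mcont_cst|exact: vcont_fst (@vcont_id R n)].
Qed.

Let measurable_near (A : 'M[R]_n) y :
  measurable [set V : borel_orth R n | near_K (A *m (val V *m y))].
Proof.
apply: orth_closed_measurable.
pose F : set (orth R n * 'cV[R]_n) :=
  [set u | enorm (A *m (val u.1 *m y) - u.2) <= 3].
rewrite (_ : [set V | _] = [set V | exists2 x, K x & F (V, x)])//.
apply: projection_closed; first by case: bK.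
apply: closed_ler; last exact: cont_cst.
apply: cont_enorm; apply: vcontB; last exact: vcont_snd (@vcont_id R n).
apply: vcontM; first exact: mcont_cst.
apply: vcontM; last exact: vcont_cst.
exact: (mcont_fst (T := 'cV[R]_n) (@mcont_val R n)).
Qed.

Lemma measurable_visit y : measurable (visit y).
Proof.
have := measurable_near 1%:M y.
by rewrite (_ : [set V : borel_orth R n | _] = visit y)//;
  apply/seteqP; split=> V /=; rewrite mul1mx.
Qed.

(** The number [M] of shadows is balanced: [exists_spread] limits it to about tau / B, and
    [small_measure] divides the probability by it. *)
Lemma orbit_small_prob (tau : R) (y : 'cV[R]_n) : 0 < tau < 1 / 2 ->
  460 * q <= tau ^+ 2 * enorm y ->
  pr P (visit y) * tau ^+ 2 <=
    16 * q ^+ 3 * ((400 * 80) * (400 * 20)) ^+ (3 * m) * tau ^+ m.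
Proof.
move=> t01 hy; have /andP[t0 t1] := t01.
have q1 : 1 <= q by rewrite ler1n.
have q0 : 0 < q by exact: lt_le_trans q1.
have tau1 : tau <= 1 by lra.
set c1 : R := 400 * 20; set c2 : R := 400 * 80.
have c11 : 1 <= c1 by rewrite /c1 -natrM ler1n.
have c21 : 1 <= c2 by rewrite /c2 -natrM ler1n.
have c10 : 0 < c1 ^+ (3 * m) by rewrite exprn_gt0// (lt_le_trans ltr01).
have c20 : 1 <= c2 ^+ (3 * m) by rewrite exprn_ege1.
have tm0 : 0 < tau ^+ m by rewrite exprn_gt0.
(* The hypothesis of [exists_spread] reads M * B / 2 < tau, so M = trunc (tau / B) satisfies it with
   a factor 2 to spare. *)
pose B := 4 * q ^+ 2 * c1 ^+ (3 * m) * tau ^+ m.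
have B0 : 0 < B by rewrite !mulr_gt0// exprn_gt0.
have -> : 16 * q ^+ 3 * (c2 * c1) ^+ (3 * m) * tau ^+ m = 4 * q * c2 ^+ (3 * m) * B.
  by rewrite exprMn /B; ring.
set p := pr P _.
have p0 : 0 <= p by exact: pr_ge0.
have mvisit := measurable_visit y.
have p1 : p <= 1.
  by rewrite -(pr_setT P); apply: pr_le => //; exact: measurableT.
pose M := Num.trunc (tau / B).
have X0 : 0 <= tau / B by rewrite divr_ge0// ltW.
have /andP[M1 M2] := truncn_itv X0.
(* If M = 0 then tau < B, and the claim follows from p <= 1. *)
have [Mz|Mpos] := posnP M.
  have tB : tau < B.
    by move: M2; rewrite -/M Mz ltr_pdivrMr// mul1r.
  apply: (@le_trans _ _ B).
    apply: le_trans (ltW tB); rewrite -[leRHS]mul1r; apply: ler_pM => //.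
      by rewrite sqr_ge0.
    by rewrite expr2 ger_pMr.
  rewrite -[leLHS]mul1r; apply: ler_wpM2r; first exact: ltW.
  have : 1 <= 4 * q by lra.
  move: (4 * q) (c2 ^+ _) c20 => a b b1 a1; nra.
have hM : q ^+ 2 * (c1 ^+ (3 * m) * (2 * M%:R * tau ^+ m)) < tau.
  have -> : q ^+ 2 * (c1 ^+ (3 * m) * (2 * M%:R * tau ^+ m)) = M%:R * B / 2.
    by rewrite /B; field.
  by move: M1; rewrite -/M ler_pdivlMr// => h; lra.
have [U [b hU]] := exists_spread m0 mn hP compact_D star_D vanishing t01 hM.
set beta := (Num.sqrt _)^-1 in hU.
have sq0 : 0 < Num.sqrt q by rewrite sqrtr_gt0.
have be0 : 0 < beta by rewrite invr_gt0.
have y0 : 0 < enorm y.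
  have : 0 < tau ^+ 2 * enorm y by apply: lt_le_trans hy; lra.
  by rewrite pmulr_rgt0// exprn_gt0.
pose sig := beta * enorm y.
have sig0 : 0 < sig by rewrite mulr_gt0.
pose W := [set v : 'cV[R]_n | near_K ((val U)^T *m v)].
have cW : closed W by exact: closed_near.
(* The bound 43 is 40 for the points of [K], plus 3 for the radius of the neighbourhood. *)
have K43 w v : D w -> W v -> `|dot (val U *m w) v| <= 43.
  move=> [w1 hw] [x Kx hx].
  have wx : `|dot w x| <= 40.
    rewrite ler_norml hw// andbT lerNl -dotNr; apply: hw.
    exact: (body_symmetrics bK).
  have -> : dot (val U *m w) v = dot w x + dot w ((val U)^T *m v - x).
    by rewrite -dotDr addrC subrK dot_mulmx.
  have h2 : `|dot w ((val U)^T *m v - x)| <= 3.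
    have cs u : dot w u <= enorm u.
      apply: le_trans (cauchy_schwarz _ _) _.
      by rewrite ler_piMl// enorm_ge0.
    rewrite ler_norml; apply/andP; split; last exact: le_trans (cs _) hx.
    by rewrite lerNl -dotNr; apply: le_trans (cs _) _; rewrite enormN.
  apply: le_trans (ler_normD _ _) _.
  have -> : 43 = 40 + 3 :> R by rewrite -natrD.
  exact: lerD.
pose G (b' : 'I_(nblk n m)) := [set V : borel_orth R n |
  W (val V *m y) /\ sig <= enorm (prj R (blk3 n m b b') *m (val V *m y))].
have large_m (b' : 'I_(nblk n m)) : measurable (G b').
  apply: (@measurableI _ _ [set V : borel_orth R n | W (val V *m y)]).
    exact: measurable_near.
  apply: orth_closed_measurable; apply: closed_ler; first exact: cont_cst.
  apply: cont_enorm; apply: vcontM; first exact: mcont_cst.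
  by apply: vcontM; [exact: mcont_val|exact: vcont_cst].
have hG (b' : 'I_(nblk n m)) : pr P (G b') * M%:R <= c2 ^+ (3 * m) * (2 / tau).
  set Z := blk3 n m b b'.
  have [w hw] := hU b'; rewrite -/Z in hw.
  pose z i := beta^-1 *: (prj R Z *m (val U *m w i)).
  pose zs := [seq z i | i <- enum 'I_M].
  have szs : size zs = M by rewrite size_map size_enum_ord.
  have Z1 : (0 < #|Z|)%N.
    apply: leq_trans (subset_leq_card (_ : blk n m 0 \subset Z)); first by rewrite card_blk0.
    by apply/fintype.subsetP => i i0; rewrite /Z /blk3 !finset.in_setU i0.
  have : pr P (G b') * (size zs)%:R <= c2 ^+ #|Z| * (2 / tau).
    (* A difference of shadows paired with [v - v'] gives four terms of size at most 43, hence 172;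
       the division by [beta] normalises the shadows to unit vectors. *)
    apply: (@small_measure R n P hP W Z y sig tau cW Z1 t01 sig0 zs (172 / beta)).
    - move=> _ /mapP[i _ ->]; have [_ h2 _] := hw i; split.
        by rewrite memvZ//; apply/suppvP; exact: prjK.
      by rewrite enormZ gtr0_norm ?invr_gt0// h2 mulVf// gt_eqF.
    - rewrite /eseparated pairwise_map; apply: pairwise_uniqP; first exact: enum_uniq.
      move=> i j _ _ ij /=; have [_ _ /(_ j ij) h3] := hw i.
      rewrite /z -scalerBr enormZ gtr0_norm ?invr_gt0// mulrC.
      by rewrite ler_pdivlMr.
    - move=> _ _ v v' /mapP[i _ ->] /mapP[j _ ->] Wv Wv' vvZ.
      have [[Di _ _] [Dj _ _]] := (hw i, hw j).
      rewrite /z -scalerBr -mulmxBr dotZl dot_mulmx prjT.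
      have /suppvP -> := vvZ.
      rewrite dotBr !dotBl [leRHS]mulrC -mulNr ler_pM2r ?invr_gt0//.
      have := K43 _ _ Di Wv; have := K43 _ _ Di Wv'.
      have := K43 _ _ Dj Wv; have := K43 _ _ Dj Wv'.
      rewrite !ler_norml => /andP[a1 a2] /andP[a3 a4] /andP[a5 a6] /andP[a7 a8].
      move: (dot _ v) (dot _ v') (dot _ v) (dot _ v') a1 a2 a3 a4 a5 a6 a7 a8.
      by move=> *; lra.
    (* Since beta^-2 = q, the requirement is tau^2 * enorm y >= (8/3) * 172 * q, and (8/3) * 172 is
       just below 460. *)
    - rewrite /sig /beta invrK.
      have -> : tau ^+ 2 * ((Num.sqrt q)^-1 * enorm y) = tau ^+ 2 * enorm y / Num.sqrt q.
        by rewrite mulrCA mulrC.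
      rewrite ler_pdivlMr//.
      have -> : 8 / 3 * (172 * Num.sqrt q) * Num.sqrt q = 8 / 3 * 172 * Num.sqrt q ^+ 2.
        by ring.
      by rewrite (sqr_sqrtr (ltW q0)); apply: le_trans hy; lra.
  rewrite szs => h; apply: le_trans h _; rewrite ler_wpM2r//.
    by rewrite divr_ge0// ltW.
  exact: (ler_weXn2l c21 (@card_blk3 n m m0 _ _)).
have pG : p <= \sum_(b' < nblk n m) pr P (G b').
  (* Invariance replaces [V] by [U^T V], so the neighbourhood of [K] becomes its image [W] under the
     fixed rotation [U]. *)
  have -> : p = pr P [set V : borel_orth R n | W (val V *m y)].
    rewrite /p /pr -(haar_preimage (orth_tr U) hP mvisit); congr (fine (P _)).
    by apply/seteqP; split=> V /=; rewrite /visit /= -mulmxA.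
  apply: pr_union => //; first exact: measurable_near.
  move=> V WV; have [b' hb'] := large_block m (val V *m y).
  apply/hasP; exists b'; first exact: mem_index_enum.
  apply/asboolP; split=> //; rewrite /sig -(enorm_orth V y).
  apply: le_trans hb' _; apply: enorm_prjS.
  by apply/fintype.subsetP => i ib; rewrite /blk3 !finset.in_setU ib orbT.
have pM : p * M%:R <= q * (c2 ^+ (3 * m) * (2 / tau)).
  apply: le_trans (ler_wpM2r (ler0n _ _) pG) _; rewrite mulr_suml.
  apply: le_trans (ler_sum _ (fun b' _ => hG b')) _.
  by rewrite sumr_const card_ord -[leLHS]mulr_natl.
have XM : tau / B <= 2 * M%:R.
  have : (1 : R) <= M%:R by rewrite ler1n.
  by move: M2; rewrite -/M -natr1 => h1 h2; lra.
rewrite ler_pdivrMr// in XM.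
have h1 : p * tau <= 2 * (p * M%:R) * B.
  apply: le_trans (ler_wpM2l p0 XM) _.
  by rewrite le_eqVlt; apply/orP; left; apply/eqP; ring.
have h2 : 2 * (p * M%:R) * B <= 2 * (q * (c2 ^+ (3 * m) * (2 / tau))) * B.
  by rewrite ler_pM2r// ler_pM2l.
have -> : p * tau ^+ 2 = p * tau * tau by ring.
rewrite -ler_pdivlMr//; apply: le_trans h1 (le_trans h2 _).
by rewrite le_eqVlt; apply/orP; left; apply/eqP; field; rewrite gt_eqF.
Qed.

End OrbitProbability.

(** * A net for the second body and measurability of the event *)

Section Assembly.
Variables (R : realType) (n : nat).
Implicit Types (K L : set 'cV[R]_n) (E F : {vspace 'cV[R]_n}).

Lemma section_radius K E : symmetric_convex_body K ->
  (diam (K `&` [set` E]) <= 1%:E)%E -> forall x, K x -> x \in E -> enorm x <= 1 / 2.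
Proof.
move=> bK dK x Kx xE.
have h : ((enorm (x - - x))%:E <= 1%:E)%E.
  apply: le_trans dK; apply: ereal_sup_ubound.
  exists (x, - x) => //; split; split => //=.
    exact: body_symmetrics bK _ Kx.
  by rewrite memvN.
move: h; rewrite lee_fin opprK -mulr2n -scaler_nat enormZ ger0_norm//; lra.
Qed.

(** Cover the part of [L] in the ball of radius [s] modulo [F], with eps = 1 / s, by projecting
    along [F] to a complement. The error [u] lies in [F] and is 2 + 1/s times a point of [L], so its
    norm is at most 3/2; the remaining term [s^-1 *: w] has norm at most 1 because [w] is in the
    ball of radius [s]. *)
Lemma orbit_cover L F (s : R) : symmetric_convex_body L ->
  (forall x, L x -> x \in F -> enorm x <= 1 / 2) -> 1 <= s ->
  exists ys : seq 'cV[R]_n, (size ys)%:R <= (5 * s) ^+ (n - \dim F) /\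
    forall x, L x -> enorm x = s -> exists2 y, y \in ys & enorm (x - y) <= 3.
Proof.
move=> bL LF s1; have cL := body_convexs bL; have sL := body_symmetrics bL.
have [r0 r00 Lr0] := body_ball bL.
have s0 : 0 < s by lra.
have disj : (F^C :&: F = 0)%VS by rewrite capvC capv_compl.
pose f := daddv_pi F^C%VS F.
pose X := [set x : 'cV[R]_n | L x /\ enorm x <= s].
have cX : convexs X.
  move=> x y l /andP[l0 l1] [Lx xs] [Ly ys]; split; first by apply: cL; rewrite ?l0.
  apply: le_trans (ler_enormD _ _) _; rewrite !enormZ !ger0_norm ?subr_ge0//.
  by have := enorm_ge0 x; have := enorm_ge0 y; nra.
have sX : symmetrics X by move=> x [Lx xs]; split; [exact: sL|rewrite enormN].
have m0 : 0 < Num.min r0 s by rewrite lt_min r00.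
have is01 : 0 < s^-1 <= 1 by rewrite invr_gt0 s0 invf_le1.
have [||ys [ysX sys hys]] := @section_cover R n F^C%VS X f (Num.min r0 s) s s^-1
    m0 is01 cX sX (fun x _ => memv_pi _ _ _).
- by move=> x [].
- move=> v vF; rewrite le_min => /andP[v1 v2]; exists v; last exact: daddv_pi_id.
  by split=> //; exact: Lr0.
exists ys; split.
  by move: sys; rewrite invrK dimv_compl dimvf /dim /= muln1.
move=> x Lx xs; have [|y yys [w [Lw ws] fu]] := hys x; first by split; rewrite ?xs.
have [Ly _] := ysX _ yys; exists y => //.
set u := x - y - s^-1 *: w in fu.
have uF : u \in F.
  have uV : u \in (F^C + F)%VS by rewrite addvC addv_complf memvf.
  rewrite -(daddv_pi_add disj uV) -/f fu add0r; exact: memv_pi.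
have is0 : 0 < s^-1 by rewrite invr_gt0.
have [n1 n2 n3 n4] : [/\ 0 <= (1 : R), 0 < 1 + 1 :> R, 0 <= 2 :> R & 0 < 2 + s^-1].
  by split=> //; exact: addr_gt0.
have [z Lz hz] := convexs_comb cL n1 n1 n2 Lx (sL _ Ly).
have [z' Lz' hz'] := convexs_comb cL n3 (ltW is0) n4 Lz (sL _ Lw).
have uz : u = (2 + s^-1) *: z'.
  rewrite -hz' -[2]/(1 + 1) -hz !scale1r /u.
  by apply/colP => i; rewrite !mxE; ring.
have z'F : z' \in F.
  have -> : z' = (2 + s^-1)^-1 *: u by rewrite uz scalerA mulVf ?scale1r ?gt_eqF.
  by rewrite memvZ.
have u1 : enorm u <= (2 + s^-1) * (1 / 2).
  by rewrite uz enormZ gtr0_norm// ler_pM2l//; exact: LF.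
have -> : x - y = u + s^-1 *: w by rewrite /u subrK.
apply: le_trans (ler_enormD _ _) _; rewrite enormZ gtr0_norm//.
have w1 : s^-1 * enorm w <= 1 by rewrite ler_pdivrMl// mulr1.
have /andP[_ is1] := is01; move: u1 w1 is1.
by move: (enorm u) (s^-1 * enorm w) (s^-1) => {hys sys} a b c; lra.
Qed.

(** The strict inequality is a countable union over [k] of the closed events that two points are at
    distance at least s + 1 / (k + 1). Points of [U L] are given by their preimages in [L], so that
    the witnesses range over a compact set independent of [U]. *)
Lemma measurable_diam_gt K L (s : R) : compact K -> compact L ->
  measurable [set U : borel_orth R n |
    (s%:E < diam (K `&` [set val U *m x | x in L]))%E].
Proof.
move=> cK cL.
pose T := (('cV[R]_n * 'cV[R]_n) * ('cV[R]_n * 'cV[R]_n))%type.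
pose C : set T := (K `*` L) `*` (K `*` L).
pose G (k : nat) : set (orth R n * T) := [set u : orth R n * T |
  [/\ forall i, u.2.1.1 i ord0 = (val u.1 *m u.2.1.2) i ord0,
      forall i, u.2.2.1 i ord0 = (val u.1 *m u.2.2.2) i ord0 &
      s + k.+1%:R^-1 <= enorm (u.2.1.1 - u.2.2.1)]].
have cG k : closed [set U : orth R n | exists2 w, C w & G k (U, w)].
  have vid := @vcont_id R n.
  have x1 := vcont_snd (S := orth R n)
    (vcont_fst (T := ('cV[R]_n * 'cV[R]_n)%type) (vcont_fst (T := 'cV[R]_n) vid)).
  have y1 := vcont_snd (S := orth R n)
    (vcont_fst (T := ('cV[R]_n * 'cV[R]_n)%type) (vcont_snd (S := 'cV[R]_n) vid)).
  have x2 := vcont_snd (S := orth R n)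
    (vcont_snd (S := ('cV[R]_n * 'cV[R]_n)%type) (vcont_fst (T := 'cV[R]_n) vid)).
  have y2 := vcont_snd (S := orth R n)
    (vcont_snd (S := ('cV[R]_n * 'cV[R]_n)%type) (vcont_snd (S := 'cV[R]_n) vid)).
  have mv := mcont_fst (T := T) (@mcont_val R n).
  apply: projection_closed; first by do 2 apply: compact_setX => //; exact: compact_setX.
  have -> : G k = [set u : orth R n * T |
        forall i, u.2.1.1 i ord0 = (val u.1 *m u.2.1.2) i ord0] `&`
      [set u : orth R n * T | forall i, u.2.2.1 i ord0 = (val u.1 *m u.2.2.2) i ord0] `&`
      [set u : orth R n * T | s + k.+1%:R^-1 <= enorm (u.2.1.1 - u.2.2.1)].
    by apply/seteqP; split=> u => [[]|[[]]].
  apply: closedI; first apply: closedI.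
  - by apply: closed_all => i; apply: closed_eqr; [exact: x1|exact: (vcontM mv y1)].
  - by apply: closed_all => i; apply: closed_eqr; [exact: x2|exact: (vcontM mv y2)].
  - apply: closed_ler; first by move=> u; exact: cvg_cst.
    exact: cont_enorm (vcontB x1 x2).
have -> : [set U : borel_orth R n |
    (s%:E < diam (K `&` [set val U *m x | x in L]))%E] =
    \bigcup_k [set U : borel_orth R n | exists2 w, C w & G k (U, w)].
  apply/seteqP; split=> U /=.
    move=> /ereal_sup_gt[_ [[x x'] [[Kx [y Ly yx]] [Kx' [y' Ly' yx']]] <-]].
    rewrite lte_fin /= => lt; have d0 : 0 < enorm (x - x') - s by rewrite subr_gt0.
    exists (Num.trunc (enorm (x - x') - s)^-1) => //.
    exists ((x, y), (x', y')) => //; split=> /= [i|i|]; rewrite ?yx ?yx'//.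
    rewrite -lerBrDl invf_ple ?posrE//; exact/ltW/truncnS_gt.
  move=> [k _ [[[x y] [x' y']] [[/= Kx Ly] [/= Kx' Ly']] [/= h1 h2 h3]]].
  apply: (@lt_le_trans _ _ (enorm (x - x'))%:E).
    by rewrite lte_fin; apply: lt_le_trans h3; rewrite ltrDl invr_gt0 ltr0n.
  apply: ereal_sup_ubound; exists (x, x') => //; split; split=> //=.
    by exists y => //; apply/colP => i; rewrite h1.
  by exists y' => //; apply/colP => i; rewrite h2.
by apply: bigcup_measurable => k _; apply: orth_closed_measurable; exact: cG.
Qed.

Lemma diam_gt_point (A : set 'cV[R]_n) (s : R) :
  ((2 * s)%:E < diam A)%E -> exists2 x, A x & s < enorm x.
Proof.
move=> /ereal_sup_gt[_ [[x x'] [/= Ax Ax'] <-]]; rewrite lte_fin /= => lt.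
have := lt_le_trans lt (ler_enormB x x') => h.
have [xs|xs] := ltP s (enorm x); first by exists x.
by exists x' => //; lra.
Qed.

End Assembly.

(** * Union bound over the net *)

Section UnionBound.
Variables (R : realType) (n : nat).
Implicit Types (K L : set 'cV[R]_n) (E F : {vspace 'cV[R]_n}).

Lemma diam_tail_bound (P : probability (borel_orth R n) R) K L E F (m : nat)
    (s tau : R) : is_haar P ->
  symmetric_convex_body K -> symmetric_convex_body L ->
  (forall x, K x -> x \in E -> enorm x <= 1 / 2) ->
  (forall x, L x -> x \in F -> enorm x <= 1 / 2) ->
  (0 < m)%N -> (3 * m <= \dim E)%N -> 0 < tau < 1 / 2 -> 6 <= s ->
  920 * (nblk n m)%:R <= tau ^+ 2 * s ->
  pr P [set U : borel_orth R n |
      ((2 * s)%:E < diam (K `&` [set val U *m x | x in L]))%E] * tau ^+ 2 <=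
    (5 * s) ^+ (n - \dim F) *
    (16 * (nblk n m)%:R ^+ 3 * (400 * 80 * (400 * 20)) ^+ (3 * m) * tau ^+ m).
Proof.
move=> hP bK bL KE LF m0 mE tau01 s6 hq.
have s1 : 1 <= s by lra.
have s0 : 0 < s by lra.
have [ys [sys hys]] := orbit_cover bL LF s1.
set A := [set U : borel_orth R n | _].
set B := 16 * _ * _ * _.
have cK : compact K by case: bK.
have cL : compact L by case: bL.
have mA : measurable A by exact: measurable_diam_gt.
(* A net point within 3 of a vector of norm [s] has norm at least s - 3 >= s / 2, by s >= 6. The
   others are discarded, because [orbit_small_prob] needs a lower bound on [enorm y]; halving the
   norm turns 460 into 920. *)
pose ys' := [seq y <- ys | s / 2 <= enorm y].
have cov V : A V -> has (fun y => `[< visit K y V >]) ys'.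
  move=> /diam_gt_point[x [Kx [y0 Ly0 yx]]]; rewrite -yx in Kx * => lt.
  have l01 : 0 <= s / enorm (val V *m y0) <= 1.
    have xp := lt_trans s0 lt; apply/andP; split; first by rewrite divr_ge0 ?ltW.
    by rewrite ler_pdivrMr// mul1r ltW.
  have Kl := convexsZ (body_convexs bK) (body_symmetrics bK) l01 Kx.
  have Ll := convexsZ (body_convexs bL) (body_symmetrics bL) l01 Ly0.
  move: lt l01 Kl Ll; rewrite enorm_orth => lt; set l := s / _ => l01 Kl Ll.
  have nl : enorm (l *: y0) = s.
    have /andP[l0 _] := l01; rewrite enormZ ger0_norm// /l divfK// gt_eqF//.
    exact: lt_trans lt.
  have [y yys hy] := hys _ Ll nl.
  apply/hasP; exists y.
    rewrite mem_filter yys andbT.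
    have := ler_enormD (l *: y0 - y) y; rewrite subrK nl.
    by move: hy s6; move: (enorm _) (enorm y) => u v; lra.
  apply/asboolP; exists (l *: (val V *m y0)) => //.
  by rewrite scalemxAr -mulmxBr enorm_orth enorm_distC.
have mF y : measurable (visit K y) by exact: measurable_visit.
have t2 : 0 <= tau ^+ 2 by exact: sqr_ge0.
apply: le_trans (ler_wpM2r t2 (pr_union P mA mF cov)) _.
rewrite mulr_suml big_filter.
have B0 : 0 <= B.
  have c0 : 0 <= 400 * 80 * (400 * 20) :> R by lra.
  have /andP[t0 _] := tau01.
  apply: mulr_ge0; last exact: exprn_ge0 (ltW t0).
  apply: mulr_ge0; last exact: exprn_ge0.
  by rewrite mulr_ge0 ?exprn_ge0 ?ler0n.
apply: (@le_trans _ _ (\sum_(y <- ys | s / 2 <= enorm y) B)).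
  apply: ler_sum => y hy; apply: (orbit_small_prob hP bK m0 KE mE tau01).
  apply: (le_trans (y := tau ^+ 2 * (s / 2))); last exact: ler_wpM2l.
  by move: hq; rewrite mulrA; move: (tau ^+ 2 * s) ((nblk n m)%:R) => u v; lra.
apply: (@le_trans _ _ (\sum_(y <- ys) B)).
  by rewrite big_mkcond; apply: ler_sum => y _; case: ifP.
by rewrite big_const_seq count_predT iter_addr_0 -[B *+ _]mulr_natl ler_wpM2r.
Qed.

End UnionBound.

(** * Choice of the block size and of the constants *)

(** The ratio (m - 2) / k is smallest at k = 35, m = 11, where it is 9/35, slightly above 13/51. *)
Lemma third_bounds (k m : nat) : (34 <= k)%N -> (k <= 3 * m + 2)%N -> (3 * m <= k)%N ->
  [/\ (2 <= m)%N, (m - 2 <= k)%N & (13 * k <= 51 * (m - 2))%N].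
Proof. by move=> *; split; lia. Qed.

Lemma third_exists (n k : nat) : (34 <= k)%N -> (k <= n)%N ->
  exists m : nat, [/\ (k <= 3 * m + 2)%N, (3 * m <= k)%N, (0 < m)%N &
    (nblk n m * k <= 8 * n)%N].
Proof.
move=> k34 kn; exists (k %/ 3)%N; split; try lia.
have h1 : (n %/ (k %/ 3) * (k %/ 3) <= n)%N by exact: leq_divM.
have h2 : (k <= 4 * (k %/ 3))%N by lia.
rewrite /nblk; move: (n %/ _)%N h1 => q h1; nia.
Qed.

Section Numerics.
Variable R : realType.

Lemma le_ln_addexpR (c x : R) : 0 <= c -> x <= ln (c + expR x).
Proof.
move=> c0; rewrite -{1}(expRK x) ler_ln ?posrE ?expR_gt0 ?lerDr//.
by rewrite ltr_wpDl ?expR_gt0.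
Qed.

Lemma expR_lt_half (x : R) : x <= - 2 -> expR x < 1 / 2.
Proof.
move=> x2; rewrite -[x]opprK expRN mul1r ltf_pV2 ?posrE ?expR_gt0//.
by apply: lt_le_trans (expR_ge1Dx _); lra.
Qed.

(** In exponential form, with t = e^T and n / k = e^rho, the claim per unit of [k] is (2 + T) * a +
    4 * a * rho + 2 * D + l - 13 * T / 102 < - T / 16. The first term is at most 0.03 * T + 0.06,
    the second at most T / 100, and 2 * D + l at most T / 50 - 1; these leave 0.06 * T against
    13/102 - 1/16 > 0.064. *)
Lemma tail_exponent (k j m q : nat) (a t r D l T rho C : R) :
  0 < a -> a < 3 / 100 -> (0 < k)%N -> (1 <= j)%N -> j%:R <= a * k%:R ->
  (34 <= k)%N -> (k <= 3 * m + 2)%N -> (3 * m <= k)%N ->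
  q%:R <= 8 * r -> r = expR rho -> 0 <= rho -> t = expR T ->
  0 <= l -> 0 <= D ->
  400 <= C -> C * (a * rho) <= T -> 50 * (2 * D + l + 1) <= T ->
  16 * (8 ^+ 3) <= expR D ->
  (5 * (t * r / 2)) ^+ j *
    (16 * q%:R ^+ 3 * expR D ^+ (3 * m) * expR (l - T / 2) ^+ m) <
  t `^ (- (k%:R / 16)) * expR (l - T / 2) ^+ 2.
Proof.
move=> a0 a3 k0 j1 jak k34 km mk qr rE rho0 tE l0 D0 C400 CT TD hD.
have k0' : 0 < k%:R :> R by rewrite ltr0n.
(* The cube of n / k is absorbed because 1 <= j <= a * k: its exponent 3 * rho is at most 3 * rho *
   (a * k). *)
have h2 : 16 * q%:R ^+ 3 <= expR (k%:R * D + 3 * rho * (a * k%:R)).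
  have q3 : q%:R ^+ 3 <= (8 * r) ^+ 3.
    by apply: lerXn2r; rewrite ?nnegrE// rE mulr_ge0 ?expR_ge0.
  apply: (@le_trans _ _ (expR D * r ^+ 3)).
    apply: (@le_trans _ _ (16 * (8 * r) ^+ 3)); first by rewrite ler_pM2l.
    by rewrite exprMn mulrA ler_wpM2r// rE exprn_ge0 ?expR_ge0.
  rewrite rE -expRM_natl -expRD ler_expR.
  have ak : 1 <= a * k%:R by apply: le_trans jak; rewrite ler1n.
  have kk : 1 <= k%:R :> R by rewrite ler1n.
  have rho3 : 0 <= 3 * rho by rewrite mulr_ge0.
  by apply: lerD; [rewrite ler_peMl|rewrite ler_peMr].
move=> {hD}.
have T0 : 0 < T by lra.
have h1 : (5 * (t * r / 2)) ^+ j <= expR ((2 + T + rho) * (a * k%:R)).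
  have h : 5 * (t * r / 2) <= expR (2 + T + rho).
    have -> : expR (2 + T + rho) = expR 2 * (t * r) by rewrite tE rE -!expRD addrA.
    have e2 : 3 <= expR 2 :> R by apply: le_trans (expR_ge1Dx _); lra.
    have tr0 : 0 < t * r by rewrite tE rE mulr_gt0 ?expR_gt0.
    by move: (t * r) (expR 2) tr0 e2 => u v; nra.
  have s0 : 0 <= 5 * (t * r / 2).
    by rewrite tE rE !mulr_ge0 ?expR_ge0.
  apply: le_trans (lerXn2r _ _ _ h) _; rewrite ?nnegrE ?expR_ge0//.
  rewrite -expRM_natl ler_expR mulrC; apply: ler_wpM2l => //; lra.
have h3 : expR D ^+ (3 * m) <= expR (k%:R * D).
  by rewrite -expRM_natl ler_expR ler_wpM2r ?ler_nat//; lra.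
have [m2 mk2 mk13] := third_bounds k34 km mk.
have -> : expR (l - T / 2) ^+ m = expR (l - T / 2) ^+ (m - 2) * expR (l - T / 2) ^+ 2.
  by rewrite -exprD subnK.
rewrite mulrA [X in X < _]mulrA ltr_pM2r ?exprn_gt0 ?expR_gt0//.
have h4 : expR (l - T / 2) ^+ (m - 2) <= expR (k%:R * l - 13 / 102 * k%:R * T).
  rewrite -expRM_natl ler_expR mulrBr.
  have e1 : (m - 2)%:R <= k%:R :> R by rewrite ler_nat.
  have e2 : 13 / 102 * k%:R <= (m - 2)%:R / 2 :> R.
    by move: mk13; rewrite -(ler_nat R) !natrM; move: (_%:R) (k%:R) => u v; lra.
  by move: e1 e2 l0 T0; move: ((m - 2)%:R) (k%:R) => u v; nra.
have -> : t `^ (- (k%:R / 16)) = expR (- (k%:R / 16) * T).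
  by rewrite tE /powR gt_eqF ?expR_gt0// expRK.
apply: (@le_lt_trans _ _ (expR ((2 + T + rho) * (a * k%:R)) *
  (expR (k%:R * D + 3 * rho * (a * k%:R)) * expR (k%:R * D)) *
  expR (k%:R * l - 13 / 102 * k%:R * T))).
  have p0 (x : R) (i : nat) : 0 <= expR x ^+ i by rewrite exprn_ge0 ?expR_ge0.
  have p1 : 0 <= (5 * (t * r / 2)) ^+ j by rewrite exprn_ge0// tE rE !mulr_ge0 ?expR_ge0.
  have p2 : 0 <= 16 * q%:R ^+ 3 :> R by rewrite mulr_ge0 ?exprn_ge0.
  apply: ler_pM => //; first by rewrite mulr_ge0// mulr_ge0.
  by apply: ler_pM => //; exact: ler_pM.
rewrite -!expRD ltr_expR.
have -> : (2 + T + rho) * (a * k%:R) + (k%:R * D + 3 * rho * (a * k%:R) + k%:R * D)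
   + (k%:R * l - 13 / 102 * k%:R * T) =
   k%:R * ((2 + T) * a + 4 * (a * rho) + 2 * D + l - 13 / 102 * T) by ring.
have -> : - (k%:R / 16) * T = k%:R * (- T / 16) :> R by ring.
rewrite ltr_pM2l//.
have ar : 400 * (a * rho) <= T.
  apply: le_trans CT; rewrite ler_wpM2r// mulr_ge0// ltW//.
have aT : (2 + T) * a <= (2 + T) * (3 / 100) by rewrite ler_wpM2l ?ltW//; lra.
by move: ar aT TD; move: (a * rho) ((2 + T) * a) => u v; lra.
Qed.

End Numerics.

Theorem theorem1 (R : realType) :
  exists C c : R, 0 < C /\ 0 < c /\
  forall (n k : nat) (a : R) (K L : set 'cV[R]_n),
    (1 <= n)%N -> (1 <= k <= n)%N -> 0 < a -> a < 3 / 100 ->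
    symmetric_convex_body K -> symmetric_convex_body L ->
    (exists E F : {vspace 'cV[R]_n},
      [/\ (k <= \dim E)%N,
          n%:R - a * k%:R <= (\dim F)%:R,
          (diam (K `&` [set` E]) <= 1%:E)%E &
          (diam (L `&` [set` F]) <= 1%:E)%E]) ->
    forall t : R, C * (n%:R / k%:R) `^ (C * a) < t ->
    forall P : probability (borel_orth R n) R, is_haar P ->
      (P [set U : borel_orth R n |
            (t * n%:R / k%:R)%:E < diam (K `&` [set val U *m x | x in L])]
        < ((c * t) `^ (- (k%:R / 16)))%:E)%E.
Proof.
have [D D0 HD] : exists2 D : R, 0 <= D &
    16 * 8 ^+ 3 <= expR D /\ expR D = 400 * 80 * (400 * 20).
  exists (ln (400 * 80 * (400 * 20))); first by apply: ln_ge0; lra.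
  by rewrite lnK ?posrE; lra.
(* This gives tau = 128 / sqrt t, so tau^2 * s = 8192 * (n / k), which exceeds 920 * 8 * (n / k) as
   the bound on the number of blocks requires. *)
have [l l0 el] : exists2 l : R, 0 <= l & expR l = 128.
  by exists (ln 128); rewrite ?lnK ?posrE// ln_ge0//; lra.
(* All absolute constants are paid for by ln t > ln C, and the dependence on n / k by the exponent C
   * a. Hence c = 1 suffices. *)
have [C C400 lC] : exists2 C : R, 400 < C & 50 * (2 * D + l + 1) <= ln C.
  exists (400 + expR (50 * (2 * D + l + 1))); first by rewrite ltrDl expR_gt0.
  exact: le_ln_addexpR (ler0n R 400).
exists C, 1; have C0 : 0 < C := lt_trans (ltr0n _ 400) C400.
split=> //; split=> // n k a K L n1 /andP[k1 kn] a0 a3 bK bL [E [F [kE aF dE dF]]] t Ct P hP.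
rewrite mul1r.
have KE := section_radius bK dE; have LF := section_radius bL dF.
have k0 : 0 < k%:R :> R by rewrite ltr0n.
have n0 : 0 < n%:R :> R by rewrite ltr0n.
pose r : R := n%:R / k%:R.
have r1 : 1 <= r by rewrite ler_pdivlMr// mul1r ler_nat.
have r0 : 0 < r := lt_le_trans ltr01 r1.
have rho0 : 0 <= ln r by exact: ln_ge0.
have Cp : 0 < C * r `^ (C * a) by rewrite mulr_gt0 ?powR_gt0.
have t0 : 0 < t := lt_trans Cp Ct.
have Tl : ln C + C * (a * ln r) < ln t.
  have := Ct; rewrite -/r -ltr_ln ?posrE// lnM ?posrE ?powR_gt0//.
  by rewrite ln_powR mulrA.
have Car : 0 <= C * (a * ln r) by rewrite pmulr_rge0// pmulr_rge0.
have TD : 50 * (2 * D + l + 1) <= ln t by lra.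
have t400 : 400 < t.
  apply: lt_trans C400 _; apply: le_lt_trans Ct; rewrite ler_peMr ?(ltW C0)//.
  by rewrite -[leLHS](powRr0 r) ler_powR// ltW// mulr_gt0.
pose s := t * r / 2.
have -> : t * n%:R / k%:R = 2 * s by rewrite /s /r; field; rewrite gt_eqF.
have s6 : 6 <= s by rewrite /s; nra.
set A := [set U | _].
have mA : measurable A by apply: measurable_diam_gt; [case: bK|case: bL].
rewrite (prE P mA) lte_fin.
have pw : 0 < t `^ (- (k%:R / 16)) by exact: powR_gt0.
have dFn : (\dim F <= n)%N by have := dimvS (subvf F); rewrite dimvf /dim /= muln1.
(* If F is the whole space, every point of [L] has norm at most 1/2 and the event is empty. *)
have [nF|Fn] := leqP n (\dim F).
  suff -> : A = set0 by rewrite /pr measure0.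
  apply/seteqP; split=> // U /diam_gt_point[x [_ [y Ly <-]]].
  rewrite enorm_orth => sy.
  have yF : y \in F.
    suff -> : F = fullv by rewrite memvf.
    by apply/eqP; rewrite eqEdim subvf dimvf /dim /= muln1.
  by have := lt_le_trans sy (LF y Ly yF); lra.
have jak : (n - \dim F)%:R <= a * k%:R by rewrite natrB// lerBlDr addrC -lerBlDr.
have j1 : (1 <= n - \dim F)%N by rewrite subn_gt0.
(* For k <= 33 the product a * k would stay below 0.99, whereas it is at least the positive integer
   n - dim F. *)
have k34 : (34 <= k)%N.
  rewrite leqNgt; apply/negP; rewrite ltnS -(ler_nat R) => k33.
  have j1' : 1 <= a * k%:R by apply: le_trans jak; rewrite ler1n.
  have := ler_pM (ltW a0) (ltW k0) (ltW a3) k33.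
  by move: j1'; move: (a * k%:R) => u; lra.
have [m [km mk m0 qk]] := third_exists k34 kn.
have qr : (nblk n m)%:R <= 8 * r by rewrite /r mulrA ler_pdivlMr// -!natrM ler_nat.
pose tau := expR (l - ln t / 2).
have tauE : tau ^+ 2 * t = 128 ^+ 2.
  rewrite /tau -expRM_natl -{2}(lnK (x := t)) ?posrE// -expRD -el -expRM_natl.
  by congr expR; field.
have tau01 : 0 < tau < 1 / 2.
  rewrite expR_gt0 expR_lt_half//.
  by move: TD D0 l0; move: (ln t) => T; lra.
have hq : 920 * (nblk n m)%:R <= tau ^+ 2 * s.
  have -> : tau ^+ 2 * s = (tau ^+ 2 * t) * r / 2 by rewrite /s; ring.
  rewrite tauE; move: qr r0; move: (nblk n m)%:R => u; lra.
have tb := diam_tail_bound hP bK bL KE LF m0 (leq_trans mk kE) tau01 s6 hq.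
have tau2 : 0 < tau ^+ 2 by rewrite exprn_gt0// expR_gt0.
rewrite -(ltr_pM2r tau2); apply: le_lt_trans tb _.
have [hD <-] := HD.
apply: (tail_exponent (rho := ln r) (T := ln t) (C := C) a0 a3 k1 j1 jak k34 km mk qr) => //.
- by rewrite lnK.
- by rewrite lnK.
- exact: ltW.
- by apply: le_trans (ltW Tl); rewrite lerDr; apply: le_trans lC; lra.
Qed.
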